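(* Let $\ast$ be a star operation of finite type on an integral domain $R$. The following statements are equivalent: (i) $R$ is $\ast$-integrally closed and $\ast$-stable; (ii) $R$ is $\tilde{\ast}$-integrally closed and $\tilde{\ast}$-stable; (iii) $R$ is integrally closed and $\tilde{\ast}$-stable; (iv) $R$ is a $\ast$-stable P$\ast$MD; (v) $R$ is a strongly $\ast$-discrete P$\ast$MD of $\ast$-finite character; (vi) $R$ is integrally closed, strongly $\ast$-discrete and (Clifford) $\tilde{\ast}$-regular. Under any one of these conditions, $\tilde{\ast}=w$.
   Context: $R$ is an integral domain with field of fractions $K$. An ideal of $R$ means a nonzero fractional ideal (an integral ideal if contained in $R$); prime ideals are integral and nonzero. $\mathcal F(R)$ is the set of ideals, and $(J:I)=\{x\in K: xI\subseteq J\}$. A star operation on $R$ is a map $\mathcal F(R)\to\mathcal F(R)$, $I\mapsto I^\ast$, such that for all $0\ne a\in K$ and $I,J\in\mathcal F(R)$: $R^\ast=R$ and $(aI)^\ast=aI^\ast$; $I\subseteq I^\ast$, and $I\subseteq J$ implies $I^\ast\subseteq J^\ast$; $I^{\ast\ast}=I^\ast$. It is of finite type if $I^\ast=\bigcup\{J^\ast: J\subseteq I,\ J \text{ a finitely generated ideal}\}$ for all $I$. $I$ is a $\ast$-ideal if $I=I^\ast$; a $\ast$-prime is a prime ideal that is a $\ast$-ideal; a $\ast$-maximal ideal is a maximal element of the set of proper integral $\ast$-ideals; $\ast\text{-Max}(R)$ is the set of $\ast$-maximal ideals. For $\ast$ of finite type, $\tilde{\ast}$ is the star operation $I\mapsto\bigcap_{M\in\ast\text{-Max}(R)}IR_M$.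 $I^v=(R:(R:I))$, $I^t=\bigcup\{J^v: J\subseteq I \text{ a finitely generated ideal}\}$, and $w=\tilde t$. For a star operation $\ast$: an ideal $I$ is $\ast$-stable if, with $E:=(I^\ast:I^\ast)$, one has $(I^\ast(E:I^\ast))^\ast=E$ (i.e. $I^\ast$ is invertible in $E$ with respect to the restriction of $\ast$ to ideals of $E$); $R$ is $\ast$-stable if every ideal is $\ast$-stable. $R$ is (Clifford) $\ast$-regular if for every ideal $I$ of $R$ there is an ideal $J$ of $R$ with $I^\ast=(I^2J)^\ast$. $R$ is $\ast$-integrally closed if $R=R^{[\ast]}$, where $R^{[\ast]}=\bigcup\{(J^\ast:J^\ast): J \text{ a finitely generated ideal of } R\}$. For $\ast$ of finite type, $R$ is a P$\ast$MD if each finitely generated ideal $I$ satisfies $(I(R:I))^\ast=R$. $R$ is strongly $\ast$-discrete if $P\neq (P^2)^\ast$ for each $\ast$-prime ideal $P$. $R$ has $\ast$-finite character if each nonzero element of $R$ is contained in at most finitely many $\ast$-maximal ideals. *)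

(* Defs.v *)
From HB Require Import structures.
From mathcomp Require Import all_boot all_order all_algebra.
From mathcomp Require Import all_classical.

Set Implicit Arguments.
Unset Strict Implicit.
Unset Printing Implicit Defensive.

Import GRing.Theory.

Local Open Scope classical_set_scope.
Local Open Scope ring_scope.

Local Notation "x %:F" := (tofrac x).

Definition ring_set (R : idomainType) : set {fraction R} :=
  range (@tofrac R).
Arguments ring_set R : clear implicits.

Definition submodule (R : idomainType) (I : set {fraction R}) : Prop :=
  [/\ I 0,
      forall x y, I x -> I y -> I (x + y) &
      forall (r : R) x, I x -> I (r%:F * x)].

(* Following the usual convention for star operations, an "ideal" is a nonzero
   fractional ideal of R. *)
Definition ideal (R : idomainType) (I : set {fraction R}) : Prop :=
  [/\ submodule I,
      exists2 x, I x & x != 0 &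
      exists2 d : R, d != 0 & forall x, I x -> ring_set R (d%:F * x)].

Definition integral_ideal (R : idomainType) (I : set {fraction R}) : Prop :=
  ideal I /\ I `<=` ring_set R.

Definition prime_ideal (R : idomainType) (P : set {fraction R}) : Prop :=
  [/\ integral_ideal P, P <> ring_set R &
      forall a b : R, P (a * b)%:F -> P a%:F \/ P b%:F].

Definition span (R : idomainType) (n : nat) (g : 'I_n -> {fraction R}) :
    set {fraction R} :=
  [set x | exists c : 'I_n -> R, x = \sum_(i < n) (c i)%:F * g i].

Definition fg_ideal (R : idomainType) (I : set {fraction R}) : Prop :=
  ideal I /\ exists (n : nat) (g : 'I_n -> {fraction R}), I = span g.

Definition scale_set (R : idomainType) (a : {fraction R})
    (I : set {fraction R}) : set {fraction R} :=
  [set a * x | x in I].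

Definition prod_set (R : idomainType) (I J : set {fraction R}) :
    set {fraction R} :=
  [set z | exists (n : nat) (x y : 'I_n -> {fraction R}),
     (forall i, I (x i) /\ J (y i)) /\ z = \sum_(i < n) x i * y i].

(* [colon J I] is (J : I), computed in the field of fractions. *)
Definition colon (R : idomainType) (J I : set {fraction R}) :
    set {fraction R} :=
  [set x | scale_set x I `<=` J].

Definition localization (R : idomainType) (M : set {fraction R}) :
    set {fraction R} :=
  [set x | exists a s : R, ~ M s%:F /\ x = a%:F / s%:F].

(* A star operation is represented by a function on all subsets of the field of
   fractions; only its values on ideals are constrained, and it is only ever
   used on ideals. *)
Record star_operation (R : idomainType)
    (star : set {fraction R} -> set {fraction R}) : Prop := StarOperation {
  star_ideal_closed : forall I, ideal I -> ideal (star I);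
  star_ring : star (ring_set R) = ring_set R;
  star_scale : forall a I, a != 0 -> ideal I ->
    star (scale_set a I) = scale_set a (star I);
  star_extensive : forall I, ideal I -> I `<=` star I;
  star_monotone : forall I J, ideal I -> ideal J -> I `<=` J ->
    star I `<=` star J;
  star_idempotent : forall I, ideal I -> star (star I) = star I
}.

Definition finite_type (R : idomainType)
    (star : set {fraction R} -> set {fraction R}) : Prop :=
  forall I, ideal I ->
    star I = \bigcup_(J in [set J | fg_ideal J /\ J `<=` I]) star J.

Definition star_ideal (R : idomainType)
    (star : set {fraction R} -> set {fraction R}) (I : set {fraction R}) :
    Prop :=
  ideal I /\ I = star I.

Definition star_prime (R : idomainType)
    (star : set {fraction R} -> set {fraction R}) (P : set {fraction R}) :
    Prop :=
  prime_ideal P /\ star_ideal star P.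

Definition proper_integral_star_ideal (R : idomainType)
    (star : set {fraction R} -> set {fraction R}) (I : set {fraction R}) :
    Prop :=
  [/\ integral_ideal I, I <> ring_set R & star_ideal star I].

Definition star_Max (R : idomainType)
    (star : set {fraction R} -> set {fraction R}) : set (set {fraction R}) :=
  [set M | proper_integral_star_ideal star M /\
     forall N, proper_integral_star_ideal star N -> M `<=` N -> N = M].

(* When there is no star-maximal ideal, which for star of finite type means
   that R is a field, the empty intersection is the field of fractions. *)
Definition star_tilde (R : idomainType)
    (star : set {fraction R} -> set {fraction R}) (I : set {fraction R}) :
    set {fraction R} :=
  \bigcap_(M in star_Max star) prod_set I (localization M).

Definition v_op (R : idomainType) (I : set {fraction R}) : set {fraction R} :=
  colon (ring_set R) (colon (ring_set R) I).

Definition t_op (R : idomainType) (I : set {fraction R}) : set {fraction R} :=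
  \bigcup_(J in [set J | fg_ideal J /\ J `<=` I]) v_op J.

Definition w_op (R : idomainType) : set {fraction R} -> set {fraction R} :=
  star_tilde (@t_op R).

Definition ideal_star_stable (R : idomainType)
    (star : set {fraction R} -> set {fraction R}) (I : set {fraction R}) :
    Prop :=
  let E := colon (star I) (star I) in
  star (prod_set (star I) (colon E (star I))) = E.

Definition star_stable (R : idomainType)
    (star : set {fraction R} -> set {fraction R}) : Prop :=
  forall I, ideal I -> ideal_star_stable star I.

Definition clifford_star_regular (R : idomainType)
    (star : set {fraction R} -> set {fraction R}) : Prop :=
  forall I, ideal I ->
    exists2 J, ideal J & star I = star (prod_set (prod_set I I) J).

Definition star_integral_closure (R : idomainType)
    (star : set {fraction R} -> set {fraction R}) : set {fraction R} :=
  \bigcup_(J in [set J | fg_ideal J]) colon (star J) (star J).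

Definition star_integrally_closed (R : idomainType)
    (star : set {fraction R} -> set {fraction R}) : Prop :=
  ring_set R = star_integral_closure star.

Definition integrally_closed (R : idomainType) : Prop :=
  forall x : {fraction R}, integralOver (@tofrac R) x -> ring_set R x.

Definition PstarMD (R : idomainType)
    (star : set {fraction R} -> set {fraction R}) : Prop :=
  forall I, fg_ideal I ->
    star (prod_set I (colon (ring_set R) I)) = ring_set R.

Definition strongly_star_discrete (R : idomainType)
    (star : set {fraction R} -> set {fraction R}) : Prop :=
  forall P, star_prime star P -> P <> star (prod_set P P).

Definition star_finite_character (R : idomainType)
    (star : set {fraction R} -> set {fraction R}) : Prop :=
  forall x : R, x != 0 -> finite_set [set M | star_Max star M /\ M x%:F].

(* Main.v *)
(* For an ideal I put E = (I* : I* ). A domain satisfying any of the conditions is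
   a P*MD: under (i) and (ii), I* with I finitely generated has E = R and stability
   makes it invertible; under (iii), the determinant trick reduces this to (ii);
   under (vi), I~ = (I^2 J)~ gives IJ <= (I~ : I~) = R, and Nakayama's lemma shows
   that no *-maximal ideal contains IJ. In a P*MD every R_M, for M a *-maximal
   ideal, is a valuation ring, and *, ~*, t (hence also w) agree.

   (iv) => (v). If P = (P^2)* were a *-prime, then ((P : P) : P) = (P : P), and
   stability would put 1 in P. If a nonzero a were in distinct *-maximal ideals
   M_0, M_1, ..., then these are *-invertible, and the increasing union of the
   (R : M_0 ... M_(n-1)), which lies in R / a, is locally invertible, so it has
   endomorphism ring R; but it is not *-finite, against stability.

   (v) => (iv) and (vi) => (iv). A proper idempotent submodule L of a valuation ring
   R_M is prime, so that its trace on R is a *-prime P with P = (P^2)*; strong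
   discreteness excludes this. For (vi), take L = (I* (E : I* ))* R_M. For (v), taking
   for L the maximal ideal of (I R_M : I R_M) gives c in I with I^2 <= c I R_M; for
   each of the finitely many *-maximal N where this matters, an element s outside M
   satisfies s I^2 <= c I R_N, so a product of such s has s / c in (E : I* ), and
   s = c (s / c) shows that I* (E : I* ) is not contained in M. *)
From mathcomp Require Import all_boot perm all_algebra.
From mathcomp Require Import ring.
From mathcomp Require Import all_classical.
Require Import Defs.

Set Implicit Arguments.
Unset Strict Implicit.
Unset Printing Implicit Defensive.

Import GRing.Theory.

Local Open Scope classical_set_scope.
Local Open Scope ring_scope.

(** * Fractional ideals: products, colons, finite generation and conductors *)

Section FractionalIdeals.
Variable R : idomainType.
Implicit Types (I J L M S T : set {fraction R}) (x y z c d s : {fraction R}).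
Local Notation A := (ring_set R).

Lemma ring_setP (r : R) : A (tofrac r).
Proof. by exists r. Qed.

Lemma ring_set0 : A 0.
Proof. by exists 0 => //; rewrite tofrac0. Qed.

Lemma ring_set1 : A 1.
Proof. by exists 1 => //; rewrite tofrac1. Qed.

Lemma ring_setD x y : A x -> A y -> A (x + y).
Proof. by move=> [a _ <-] [b _ <-]; rewrite -tofracD; exact: ring_setP. Qed.

Lemma ring_setN x : A x -> A (- x).
Proof. by move=> [a _ <-]; rewrite -tofracN; exact: ring_setP. Qed.

Lemma ring_setM x y : A x -> A y -> A (x * y).
Proof. by move=> [a _ <-] [b _ <-]; rewrite -tofracM; exact: ring_setP. Qed.

Lemma ring_set_prod (T : Type) (r : seq T) (P : pred T) (F : T -> {fraction R}) :
  (forall i, P i -> A (F i)) -> A (\prod_(i <- r | P i) F i).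
Proof.
by move=> AF; apply: big_ind => //; [exact: ring_set1 | exact: ring_setM].
Qed.

Lemma submoduleM I c x : submodule I -> A c -> I x -> I (c * x).
Proof. by move=> [_ _ Ism] [r _ <-] Ix; exact: Ism. Qed.

Lemma submoduleN I x : submodule I -> I x -> I (- x).
Proof.
move=> Isub Ix; rewrite -mulN1r; apply: submoduleM Isub _ Ix.
exact/ring_setN/ring_set1.
Qed.

Lemma submodule_sum I (T : Type) (r : seq T) (P : pred T) (F : T -> {fraction R}) :
  submodule I -> (forall i, P i -> I (F i)) -> I (\sum_(i <- r | P i) F i).
Proof. by move=> [I0 ID _] IF; apply: big_ind. Qed.

Lemma ring_set_submodule : submodule A.
Proof.
split; [exact: ring_set0 | exact: ring_setD |].
by move=> r x Ax; apply: ring_setM => //; exact: ring_setP.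
Qed.

Lemma denominator x : exists d, [/\ A d, d != 0 & A (d * x)].
Proof.
pose r := repr x; exists (tofrac \d_r).
split; [exact: ring_setP | by rewrite tofrac_eq0 denom_ratioP |].
suff -> : tofrac \d_r * x = tofrac \n_r by exact: ring_setP.
rewrite -[in LHS](reprK x) -/r; unlock tofrac.
rewrite -[LHS]FracField.pi_mul; apply/eqmodP => /=.
by rewrite FracField.equivfE /FracField.mulf !numden_Ratio ?mulf_neq0 ?oner_eq0 //=
  ?mul1r ?mulr1 1?mulrC //; exact: denom_ratioP.
Qed.

Lemma idealI I : submodule I -> (exists2 x, I x & x != 0) ->
  (exists d, [/\ A d, d != 0 & forall x, I x -> A (d * x)]) -> ideal I.
Proof.
move=> Isub Inz [_ [[r _ <-] d0 dI]]; split=> //; exists r => //.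
by rewrite -tofrac_eq0.
Qed.

Lemma ideal_submodule I : ideal I -> submodule I.
Proof. by case. Qed.

Lemma ideal_bounded I : ideal I ->
  exists d, [/\ A d, d != 0 & forall x, I x -> A (d * x)].
Proof.
move=> [_ _ [r r0 rI]]; exists (tofrac r).
by split=> //; [exact: ring_setP | rewrite tofrac_eq0].
Qed.

Lemma ideal_integral_elt I : ideal I -> exists a, [/\ A a, a != 0 & I a].
Proof.
move=> [Isub [x Ix x0] _]; have [d [Ad d0 Adx]] := denominator x.
by exists (d * x); split=> //; [rewrite mulf_neq0 | exact: submoduleM].
Qed.

Lemma ideal_sub I J : ideal J -> submodule I -> (exists2 x, I x & x != 0) ->
  I `<=` J -> ideal I.
Proof.
move=> Jid Isub Inz IJ; apply: idealI => //.
have [d [Ad d0 dJ]] := ideal_bounded Jid.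
by exists d; split=> // x /IJ; exact: dJ.
Qed.

Lemma ideal_ring : ideal A.
Proof.
apply: idealI; first exact: ring_set_submodule.
  by exists 1; [exact: ring_set1 | exact: oner_neq0].
exists 1; split; [exact: ring_set1 | exact: oner_neq0 |].
by move=> x; rewrite mul1r.
Qed.

Lemma ideal_scale a I : a != 0 -> ideal I -> ideal (scale_set a I).
Proof.
move=> a0 [Isub [x Ix x0] [r r0 rI]]; have [I0 ID IM] := Isub; apply: idealI.
- split; first by exists 0 => //; rewrite mulr0.
  + by move=> _ _ [y Iy <-] [z Iz <-]; exists (y + z); [exact: ID|rewrite mulrDr].
  + move=> b _ [y Iy <-]; exists (tofrac b * y); [exact: IM | by rewrite mulrCA].
- by exists (a * x); [exists x | rewrite mulf_neq0].
have [d [Ad d0 Ada]] := denominator a.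
exists (d * tofrac r); split.
- by apply: ring_setM => //; exact: ring_setP.
- by rewrite mulf_neq0 // tofrac_eq0.
- by move=> _ [y Iy <-]; rewrite mulrACA; apply: ring_setM => //; exact: rI.
Qed.

Lemma scale_setE a I x : a != 0 -> scale_set a I x <-> I (x / a).
Proof.
move=> a0; split; first by move=> [y Iy <-]; rewrite mulrC mulKf.
by move=> Ixa; exists (x / a) => //; rewrite mulrC divfK.
Qed.

Lemma prod_set_mul I J x y : I x -> J y -> prod_set I J (x * y).
Proof.
move=> Ix Jy; exists 1%N, (fun=> x), (fun=> y).
by split=> //; rewrite big_ord1.
Qed.

Lemma prod_set_sub I J T : submodule T ->
  (forall x y, I x -> J y -> T (x * y)) -> prod_set I J `<=` T.
Proof.
move=> Tsub IJT _ [n [x [y [xy ->]]]].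
by apply: submodule_sum => // i _; have [] := xy i; exact: IJT.
Qed.

Lemma prod_set_submodule I J : submodule I -> submodule (prod_set I J).
Proof.
move=> Isub; split.
- by exists 0%N, (fun=> 0), (fun=> 0); split; [case | rewrite big_ord0].
- move=> _ _ [n [x [y [xy ->]]]] [m [x' [y' [xy' ->]]]].
  exists (n + m)%N,
    (fun i : 'I_(n + m) => match fintype.split i with inl j => x j | inr j => x' j end),
    (fun i : 'I_(n + m) => match fintype.split i with inl j => y j | inr j => y' j end).
  split; first by move=> i; case: fintype.split.
  rewrite big_split_ord /=; congr (_ + _); apply: eq_bigr => i _.
    by rewrite -[lshift _ _]/(unsplit (inl i)) unsplitK.
  by rewrite -[rshift _ _]/(unsplit (inr i)) unsplitK.
- move=> r _ [n [x [y [xy ->]]]]; exists n, (fun i => tofrac r * x i), y; split.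
    move=> i; have [Ix Jy] := xy i; split=> //.
    by apply: submoduleM => //; exact: ring_setP.
  by rewrite mulr_sumr; apply: eq_bigr => i _; rewrite mulrA.
Qed.

Lemma ideal_prod I J : ideal I -> ideal J -> ideal (prod_set I J).
Proof.
move=> Iid Jid.
have [d [Ad d0 dI]] := ideal_bounded Iid.
have [e [Ae e0 eJ]] := ideal_bounded Jid.
have [_ [x Ix x0] _] := Iid; have [_ [y Jy y0] _] := Jid.
apply: idealI; first exact/prod_set_submodule/ideal_submodule.
  by exists (x * y); [exact: prod_set_mul | rewrite mulf_neq0].
exists (d * e); split; [exact: ring_setM | by rewrite mulf_neq0 |].
move=> z [n [u [v [uv ->]]]]; rewrite mulr_sumr.
apply: submodule_sum; first exact: ring_set_submodule.
move=> i _; have [Iu Jv] := uv i.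
by rewrite mulrACA; apply: ring_setM; [exact: dI | exact: eJ].
Qed.

Lemma prod_setC I J : prod_set I J = prod_set J I.
Proof.
by apply/seteqP; split=> _ [n [x [y [xy ->]]]]; exists n, y, x;
  split=> [i|]; [by have [] := xy i | apply: eq_bigr => i _; rewrite mulrC
  | by have [] := xy i | apply: eq_bigr => i _; rewrite mulrC].
Qed.

Lemma colonP J I x : colon J I x <-> forall y, I y -> J (x * y).
Proof.
by split=> [xIJ y Iy|xIJ _ [y Iy <-]]; [apply: xIJ; exists y | exact: xIJ].
Qed.

Lemma colon_submodule J I : submodule J -> submodule (colon J I).
Proof.
move=> Jsub; have [J0 JD JM] := Jsub; split.
- by apply/colonP => y _; rewrite mul0r.
- move=> x x' /colonP Jx /colonP Jx'; apply/colonP => y Iy.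
  by rewrite mulrDl; apply: JD; [exact: Jx | exact: Jx'].
- move=> r x /colonP Jx; apply/colonP => y Iy.
  by rewrite -mulrA; apply: JM; exact: Jx.
Qed.

Lemma ideal_colon J I : ideal J -> ideal I -> ideal (colon J I).
Proof.
move=> Jid Iid; have Jsub := ideal_submodule Jid.
have [d [Ad d0 dI]] := ideal_bounded Iid.
have [e [Ae e0 eJ]] := ideal_bounded Jid.
have [a [Aa a0 Ia]] := ideal_integral_elt Iid.
have [_ [j Jj j0] _] := Jid.
apply: idealI; first exact: colon_submodule.
  exists (j * d); last by rewrite mulf_neq0.
  by apply/colonP => y Iy; rewrite -mulrA mulrC; apply: submoduleM => //; exact: dI.
exists (e * a); split; [exact: ring_setM | by rewrite mulf_neq0 |].
by move=> x /colonP xIJ; rewrite -mulrA [a * x]mulrC; apply/eJ/xIJ.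
Qed.

Lemma colon1 I : colon I I 1.
Proof. by apply/colonP => y; rewrite mul1r. Qed.

Lemma ring_set_colon I : submodule I -> A `<=` colon I I.
Proof. by move=> Isub c Ac; apply/colonP => x; exact: submoduleM. Qed.

Lemma common_denominator n (g : 'I_n -> {fraction R}) :
  exists d, [/\ A d, d != 0 & forall i, A (d * g i)].
Proof.
have /choice[d dP] : forall i, exists d, [/\ A d, d != 0 & A (d * g i)].
  by move=> i; exact: denominator.
exists (\prod_i d i); split.
- by apply: ring_set_prod => i _; have [] := dP i.
- by rewrite prodf_seq_neq0; apply/allP => i _; have [_ -> _] := dP i.
- move=> i; rewrite (bigD1 i) //= mulrAC.
  apply: ring_setM; first by have [] := dP i.
  by apply: ring_set_prod => j _; have [] := dP j.
Qed.

Lemma span_submodule n (g : 'I_n -> {fraction R}) : submodule (span g).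
Proof.
split.
- by exists (fun=> 0); rewrite big1 // => i _; rewrite tofrac0 mul0r.
- move=> _ _ [c ->] [c' ->]; exists (fun i => c i + c' i).
  by rewrite -big_split; apply: eq_bigr => i _; rewrite tofracD mulrDl.
- move=> r _ [c ->]; exists (fun i => r * c i).
  by rewrite mulr_sumr; apply: eq_bigr => i _; rewrite tofracM mulrA.
Qed.

Lemma span_gen n (g : 'I_n -> {fraction R}) i : span g (g i).
Proof.
exists (fun j => (j == i)%:R); rewrite (bigD1 i) //= eqxx big1 ?addr0.
  by rewrite tofrac1 mul1r.
by move=> j /negPf ->; rewrite tofrac0 mul0r.
Qed.

Lemma span_sub n (g : 'I_n -> {fraction R}) I : submodule I ->
  (forall i, I (g i)) -> span g `<=` I.
Proof.
move=> Isub Ig _ [c ->]; apply: submodule_sum => // i _.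
by apply: submoduleM => //; exact: ring_setP.
Qed.

Lemma fg_span n (g : 'I_n -> {fraction R}) i : g i != 0 -> fg_ideal (span g).
Proof.
move=> gi0; split; last by exists n, g.
apply: idealI; first exact: span_submodule.
  by exists (g i) => //; exact: span_gen.
have [d [Ad d0 dg]] := common_denominator g; exists d; split=> // _ [c ->].
rewrite mulr_sumr; apply: submodule_sum; first exact: ring_set_submodule.
by move=> j _; rewrite mulrCA; apply: ring_setM => //; exact: ring_setP.
Qed.

(** The ideal (x, y), presented by its minimality so that later proofs test inclusions on the two
    generators only. *)
Lemma fg_pair x y : x != 0 -> exists F : set {fraction R},
  [/\ fg_ideal F, F x, F y & forall I, submodule I -> I x -> I y -> F `<=` I].
Proof.
move=> x0; pose g := fun i : 'I_2 => if i == ord0 then x else y.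
exists (span g); split.
- exact: (@fg_span _ g ord0).
- exact: (span_gen g ord0).
- exact: (span_gen g ord_max).
- by move=> I Isub Ix Iy; apply: span_sub => // i; rewrite /g; case: ifP.
Qed.

Lemma submodule_directed (B : set (set {fraction R})) :
  (exists I, B I) -> (forall I, B I -> submodule I) ->
  (forall I J, B I -> B J -> exists L, [/\ B L, I `<=` L & J `<=` L]) ->
  submodule (\bigcup_(I in B) I).
Proof.
move=> Bnz Bsub Bdir; split.
- by have [I BI] := Bnz; exists I => //; have [] := Bsub _ BI.
- move=> x y [I BI Ix] [J BJ Jy]; have [L [BL IL JL]] := Bdir _ _ BI BJ.
  exists L => //; have [_ LD _] := Bsub _ BL.
  by apply: LD; [exact: IL | exact: JL].
- by move=> r x [I BI Ix]; exists I => //; have [_ _ IM] := Bsub _ BI; exact: IM.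
Qed.

(** Directedness absorbs the generators one at a time into a single member of the family. *)
Lemma fg_sub_directed (B : set (set {fraction R})) F :
  (exists I, B I) -> (forall I, B I -> submodule I) ->
  (forall I J, B I -> B J -> exists L, [/\ B L, I `<=` L & J `<=` L]) ->
  fg_ideal F -> F `<=` \bigcup_(I in B) I -> exists2 I, B I & F `<=` I.
Proof.
move=> Bnz Bsub Bdir [_ [n [g ->]]] FB.
suff [I BI gI] : exists2 I, B I & forall i, I (g i).
  by exists I => //; apply: span_sub => //; exact: Bsub.
have {FB} : forall i, exists2 I, B I & I (g i) by move=> i; apply: FB; exact: span_gen.
elim: n g => [|n IHn] g gB; first by have [I BI] := Bnz; exists I => // -[].
have [I BI gI] := IHn _ (fun i => gB (lift ord_max i)).
have [J BJ gJ] := gB ord_max.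
have [L [BL IL JL]] := Bdir _ _ BI BJ; exists L => // i.
by case: (unliftP ord_max i) => [j|] ->; [exact/IL/gI | exact: JL].
Qed.

(** The ideal (I : z) of [R]. It contains [1] exactly when [z] is in [I], so membership in [I]
    becomes a question about proper integral ideals. *)
Definition conductor I z : set {fraction R} := [set c | A c /\ I (c * z)].

Lemma ideal_conductor I z : ideal I -> ideal (conductor I z).
Proof.
move=> Iid; have Isub := ideal_submodule Iid; have [I0 ID IM] := Isub.
apply: (ideal_sub ideal_ring); last by move=> c [].
- split; first by split; [exact: ring_set0 | rewrite mul0r].
  + move=> x y [Ax Ix] [Ay Iy]; split; first exact: ring_setD.
    by rewrite mulrDl; exact: ID.
  + move=> r x [Ax Ix]; split; first by apply: ring_setM => //; exact: ring_setP.
    by rewrite -mulrA; exact: IM.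
- have [d [Ad d0 Adz]] := denominator z.
  have [a [Aa a0 Ia]] := ideal_integral_elt Iid.
  exists (a * d); last by rewrite mulf_neq0.
  by split; [exact: ring_setM | rewrite -mulrA mulrC; exact: submoduleM].
Qed.
End FractionalIdeals.

(** * General star operations: invertibility, stability and integral closure *)

Section StarOperation.
Variables (R : idomainType) (star : set {fraction R} -> set {fraction R}).
Hypothesis hstar : star_operation star.
Implicit Types (I J L M S T : set {fraction R}) (x y z c d s : {fraction R}).
Local Notation A := (ring_set R).

Lemma star_sub I J : ideal I -> star_ideal star J -> I `<=` J -> star I `<=` J.
Proof. by move=> Iid [Jid Jst] IJ; rewrite Jst; exact: star_monotone. Qed.

Lemma star_ideal_star I : ideal I -> star_ideal star (star I).
Proof.
by move=> Iid; split; [exact: star_ideal_closed | rewrite star_idempotent].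
Qed.

Lemma star_ideal_ring : star_ideal star A.
Proof. by split; [exact: ideal_ring | rewrite (star_ring hstar)]. Qed.

(** The closure of z I is z times the closure of I; [z = 0] is apart because z I is then no ideal.
    This is the tool for replacing [star I] by [I] in inclusions. *)
Lemma star_mull I T z : ideal I -> star_ideal star T ->
  (forall x, I x -> T (z * x)) -> forall x, star I x -> T (z * x).
Proof.
move=> Iid Tst zIT x Ix; have [Tid _] := Tst.
have [->|z0] := eqVneq z 0; first by rewrite mul0r; have [[]] := Tid.
have zIid := ideal_scale z0 Iid.
apply: (star_sub zIid Tst); first by move=> _ [y Iy <-]; exact: zIT.
by rewrite (star_scale hstar) //; exists x.
Qed.

Lemma star_mul2 I J T : ideal I -> ideal J -> star_ideal star T ->
  (forall x y, I x -> J y -> T (x * y)) ->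
  forall x y, star I x -> star J y -> T (x * y).
Proof.
move=> Iid Jid Tst IJT x y Ix Jy.
apply: (star_mull Jid) => // {y Jy} y Jy; rewrite mulrC.
by apply: (star_mull Iid) => // {x Ix} x Ix; rewrite mulrC; exact: IJT.
Qed.

Lemma star_cancel I T z : ideal I -> star I 1 -> star_ideal star T ->
  (forall x, I x -> T (z * x)) -> T z.
Proof. by move=> Iid I1 Tst zIT; rewrite -[z]mulr1; exact: star_mull zIT _ _. Qed.

Lemma star_prodl I J : ideal I -> ideal J ->
  star (prod_set (star I) J) = star (prod_set I J).
Proof.
move=> Iid Jid; have sIid := star_ideal_closed hstar Iid.
have IJid := ideal_prod Iid Jid.
apply/seteqP; split; apply: star_sub; try exact: star_ideal_star.
- exact: ideal_prod.
- apply: prod_set_sub; first exact/ideal_submodule/star_ideal_closed.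
  move=> x y Ix Jy; rewrite mulrC; apply: (star_mull Iid) => //.
    exact: star_ideal_star.
  by move=> {x Ix} x Ix; rewrite mulrC; apply: star_extensive => //; exact: prod_set_mul.
- exact: ideal_prod.
- exact/star_ideal_star/ideal_prod.
- apply: prod_set_sub; first exact/ideal_submodule/star_ideal_closed/ideal_prod.
  move=> x y Ix Jy; apply: star_extensive => //; first exact: ideal_prod.
  by apply: prod_set_mul => //; exact: star_extensive.
Qed.

Lemma star_full I : ideal I -> I `<=` A -> star I 1 -> star I = A.
Proof.
move=> Iid IA I1; apply/seteqP; split.
  exact: star_sub star_ideal_ring _.
move=> r Ar; rewrite -[r]mulr1; apply: submoduleM => //.
exact/ideal_submodule/star_ideal_closed.
Qed.

Lemma star_colonr I T : ideal I -> star_ideal star T ->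
  colon T (star I) = colon T I.
Proof.
move=> Iid Tst; apply/seteqP; split=> x /colonP xIT; apply/colonP => y Iy.
  by apply: xIT; exact: star_extensive.
exact: star_mull xIT _ Iy.
Qed.

Lemma star_ideal_colon I T : ideal I -> star_ideal star T ->
  star_ideal star (colon T I).
Proof.
move=> Iid Tst; have [Tid _] := Tst; have Cid := ideal_colon Tid Iid.
split=> //; apply/seteqP; split; first exact: star_extensive.
move=> x Cx; apply/colonP => y Iy; rewrite mulrC.
by apply: (star_mull Cid) => // {x Cx} x /colonP xIT; rewrite mulrC; exact: xIT.
Qed.

Lemma star_ideal_conductor T z : star_ideal star T ->
  star_ideal star (conductor T z).
Proof.
move=> Tst; have [Tid _] := Tst; have Cid := ideal_conductor z Tid.
split=> //; apply/seteqP; split; first exact: star_extensive.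
move=> x Cx; split; first by apply: (star_sub Cid star_ideal_ring) => // c [].
rewrite mulrC; apply: (star_mull Cid) => // {x Cx} x [_ Tx].
by rewrite mulrC.
Qed.

Lemma fg_integral_inverse I : PstarMD star -> fg_ideal I ->
  star (prod_set I (colon A I)) 1.
Proof. by move=> pmd /pmd ->; exact: ring_set1. Qed.

(** If x is in the v-closure, then x (R : I) <= R, so x I (R : I) <= I, and I (R : I) can be
    cancelled. As [v_op I] does not depend on [star], this later identifies different star
    operations. *)
Lemma PstarMD_v I : ideal I -> star (prod_set I (colon A I)) = A ->
  star I = v_op I.
Proof.
move=> Iid inv; have Cid := ideal_colon (ideal_ring R) Iid.
have ICid := ideal_prod Iid Cid.
apply/seteqP; split; last first.
  move=> x /colonP xv.
  apply: (star_cancel ICid); [by rewrite inv; exact: ring_set1| exact: star_ideal_star |].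
  move=> c [n [u [v [uv ->]]]]; rewrite mulr_sumr; apply: submodule_sum.
    exact/ideal_submodule/star_ideal_closed.
  move=> i _; have [Iu Cv] := uv i; rewrite mulrCA mulrC.
  by apply: submoduleM; [exact/ideal_submodule/star_ideal_closed | exact: xv
    | exact: star_extensive].
apply: star_sub => //; first exact/star_ideal_colon/star_ideal_ring.
by move=> x Ix; apply/colonP => y /colonP yI; rewrite mulrC; exact: yI.
Qed.

Lemma star_integral_colon I : star_integrally_closed star -> fg_ideal I ->
  colon (star I) (star I) `<=` A.
Proof. by move=> -> Ifg x Ix; exists I. Qed.

Lemma star_integrally_closedP :
  (forall I, fg_ideal I -> colon (star I) (star I) `<=` A) ->
  star_integrally_closed star.
Proof.
move=> IA; apply/seteqP; split=> [x Ax|x [I /= Ifg]]; last exact: IA.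
(* Every finitely generated ideal has [R] inside its endomorphism ring; (1, 1) = R is taken. *)
have [F [Ffg _ _ _]] := fg_pair 1 (oner_neq0 {fraction R}).
exists F => //; apply: ring_set_colon => //.
by apply/ideal_submodule/star_ideal_closed => //; have [] := Ffg.
Qed.

Lemma PstarMD_of_stable :
  star_integrally_closed star -> star_stable star -> PstarMD star.
Proof.
move=> icl stab I Ifg; have [Iid _] := Ifg.
have EA : colon (star I) (star I) = A.
  apply/seteqP; split; first exact: star_integral_colon.
  by apply: ring_set_colon; exact/ideal_submodule/star_ideal_closed.
have := stab I Iid; rewrite /ideal_star_stable /= EA star_prodl //.
  by rewrite star_colonr //; exact: star_ideal_ring.
by apply: ideal_colon; [exact: ideal_ring | exact: star_ideal_closed].
Qed.

(** If x I is in the closure of I, then x I (R : I) <= R, and I (R : I) can be cancelled. *)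
Lemma star_integrally_closed_of_PstarMD :
  PstarMD star -> star_integrally_closed star.
Proof.
move=> pmd; apply: star_integrally_closedP => I Ifg x; have [Iid _] := Ifg.
rewrite star_colonr //; last exact: star_ideal_star.
move=> /colonP xI; have Cid := ideal_colon (ideal_ring R) Iid.
apply: (star_cancel (ideal_prod Iid Cid)); first exact: fg_integral_inverse.
  exact: star_ideal_ring.
move=> c [n [u [v [uv ->]]]]; rewrite mulr_sumr; apply: submodule_sum.
  exact: ring_set_submodule.
move=> i _; have [Iu /colonP Cv] := uv i.
rewrite mulrA mulrC; apply: (star_mull Iid) => //; first exact: star_ideal_ring.
exact: xI.
Qed.

(** A root x of a monic polynomial of degree n + 1 stabilizes the ideal spanned by 1, x, ..., x^n,
    hence also its star closure. *)
Lemma integrally_closed_of_star :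
  star_integrally_closed star -> integrally_closed R.
Proof.
move=> icl x [p pmon /rootP px0].
have [n n1] : exists n, size p = n.+1.
  by exists (size p).-1; rewrite prednK // lt0n size_poly_eq0 monic_neq0.
have pn1 : p`_n = 1 by have /monicP := pmon; rewrite lead_coefE n1.
have xn : x ^+ n = - \sum_(i < n) tofrac p`_i * x ^+ i.
  apply/eqP; rewrite -addr_eq0; apply/eqP.
  by move: px0; rewrite horner_poly n1 big_ord_recr /= pn1 tofrac1 mul1r addrC.
(* A monic polynomial of degree 0 has no root; from here on the degree is [n.+1]. *)
case: n {n1 pn1} xn => [|n] xn.
  by move/eqP: xn; rewrite big_ord0 expr0 oppr0 oner_eq0.
pose g (i : 'I_n.+1) := x ^+ i.
have gfg : fg_ideal (span g) by apply: (@fg_span _ _ _ ord0); rewrite /g expr0 oner_neq0.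
apply: (star_integral_colon icl gfg).
have [gid _] := gfg; rewrite star_colonr //; last exact: star_ideal_star.
apply/colonP => y gy; apply: star_extensive => //.
suff : span g `<=` [set y | span g (x * y)] by apply.
have gsub := span_submodule g; have [g0 gD gM] := gsub.
apply: span_sub; first split => /=.
- by rewrite mulr0.
- by move=> u v /= gu gv; rewrite mulrDr; exact: gD.
- by move=> r u /= gu; rewrite mulrCA; exact: gM.
- move=> i /=; rewrite -exprS.
  have [ltin|] := ltnP i n.
    exact: (span_gen g (Ordinal (ltin : (i.+1 < n.+1)%N))).
  move=> len; have -> : i = n :> nat by apply/eqP; rewrite eqn_leq len -ltnS ltn_ord.
  rewrite xn; apply: submoduleN => //; apply: submodule_sum => // j _.
  by apply: submoduleM => //; [exact: ring_setP | exact: span_gen].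
Qed.
End StarOperation.

Lemma star_stable_ext (R : idomainType)
    (star1 star2 : set {fraction R} -> set {fraction R}) :
  star_operation star1 -> (forall I, ideal I -> star1 I = star2 I) ->
  star_stable star1 -> star_stable star2.
Proof.
move=> h1 e12 st I Iid; have := st I Iid; rewrite /ideal_star_stable /=.
rewrite -!e12 //; have sid := star_ideal_closed h1 Iid.
by apply: ideal_prod => //; do !apply: ideal_colon.
Qed.

(** * Finite type: star-maximal ideals, the local-global principle, and [star_tilde] *)

Section FiniteType.
Variables (R : idomainType) (star : set {fraction R} -> set {fraction R}).
Hypothesis hstar : star_operation star.
Hypothesis hft : finite_type star.
Implicit Types (I J L M S T : set {fraction R}) (x y z c d s : {fraction R}).
Local Notation A := (ring_set R).

Definition outside M : set {fraction R} := [set s | A s /\ ~ M s].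

Lemma star_fg I x : ideal I -> star I x ->
  exists F, [/\ fg_ideal F, F `<=` I & star F x].
Proof. by move=> Iid; rewrite hft // => -[F [Ffg FI] Fx]; exists F. Qed.

(** An element of the closure of the union is in the closure of a finitely generated F inside the
    union, and F lies in one member. The bound [J] keeps the union a fractional ideal. *)
Lemma star_ideal_directed (B : set (set {fraction R})) J :
  (exists I, B I) -> (forall I, B I -> star_ideal star I) ->
  (forall I L, B I -> B L -> exists N, [/\ B N, I `<=` N & L `<=` N]) ->
  ideal J -> (forall I, B I -> I `<=` J) ->
  star_ideal star (\bigcup_(I in B) I).
Proof.
move=> Bnz Bst Bdir Jid BJ.
have Bid I : B I -> ideal I by move=> /Bst[].
have Uid : ideal (\bigcup_(I in B) I).
  apply: (ideal_sub Jid); last by move=> x [I BI]; exact: BJ.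
  - by apply: submodule_directed => // I /Bid[].
  - by have [I BI] := Bnz; have [_ [x Ix x0] _] := Bid _ BI; exists x => //; exists I.
split=> //; apply/seteqP; split; first exact: star_extensive.
move=> x Ux; have [F [Ffg FU Fx]] := star_fg Uid Ux.
have [|I BI FI] := fg_sub_directed Bnz _ Bdir Ffg FU; first by move=> I /Bid[].
exists I => //; have [Fid _] := Ffg.
exact: (star_sub hstar Fid (Bst _ BI)).
Qed.

Lemma star_Max_exists I : proper_integral_star_ideal star I ->
  exists2 M, star_Max star M & I `<=` M.
Proof.
(* The predicate concerns [I] together with X because Zorn's lemma also asks for the union of the
   empty chain; that case gives [I] itself. *)
move=> Iprop; pose P X := proper_integral_star_ideal star (I `|` X).
have [] := @Zorn_bigcup _ P.
  move=> F FP Ftot; have [Fnz|F0] := pselect (exists X, F X); last first.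
    suff -> : \bigcup_(X in F) X = set0 by rewrite /P setU0.
    by apply/seteqP; split=> // x [X FX]; case: F0; exists X.
  pose B := [set I `|` X | X in F].
  have Bst J : B J -> proper_integral_star_ideal star J.
    by move=> [X FX <-]; exact: FP.
  have UE : I `|` \bigcup_(X in F) X = \bigcup_(J in B) J.
    apply/seteqP; split=> x.
    - move=> [Ix|[X FX Xx]]; last by exists (I `|` X); [exists X | right].
      by have [X FX] := Fnz; exists (I `|` X); [exists X | left].
    - by move=> [_ [X FX <-] [Ix|Xx]]; [left | right; exists X].
  have UA : \bigcup_(J in B) J `<=` A by move=> x [J /Bst[[_ +] _ _]]; apply.
  have Ust : star_ideal star (\bigcup_(J in B) J).
    apply: star_ideal_directed (ideal_ring R) _.
    - by have [X FX] := Fnz; exists (I `|` X), X.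
    - by move=> J /Bst[].
    - move=> _ _ [X FX <-] [Y FY <-]; have [XY|YX] := Ftot _ _ FX FY.
        by exists (I `|` Y); split=> //; [exists Y | exact: setUS].
      by exists (I `|` X); split=> //; [exists X | exact: setUS].
    - by move=> J /Bst[[]].
  rewrite /P UE; split=> //; first by split=> //; have [] := Ust.
  move=> UAE; have : A 1 := ring_set1 R.
  rewrite -UAE => -[J /Bst[[Jid JA] JnA _] J1]; apply: JnA.
  apply/seteqP; split=> // r Ar; rewrite -[r]mulr1.
  by apply: submoduleM => //; exact: ideal_submodule.
move=> X [PX Xmax]; exists (I `|` X); last by left.
split=> // N Nprop IXN; apply/seteqP; split=> //.
apply: contrapT => NIX; apply: (Xmax N).
  split; first by move=> x Xx; apply: IXN; right.
  by move=> NX; apply: NIX => x /NX; right.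
rewrite /P; suff -> : I `|` N = N by [].
by apply/setUidPr => x Ix; apply: IXN; left.
Qed.

Lemma star_Max_ideal M : star_Max star M -> ideal M.
Proof. by move=> [[[]]]. Qed.

Lemma star_Max_ring M : star_Max star M -> M `<=` A.
Proof. by move=> [[[]]]. Qed.

Lemma star_Max_star M : star_Max star M -> star_ideal star M.
Proof. by move=> [[]]. Qed.

Lemma proper_star_idealP I : star_ideal star I -> I `<=` A -> ~ I 1 ->
  proper_integral_star_ideal star I.
Proof.
move=> Ist IA I1; split=> //; first by split=> //; case: Ist.
by move=> IAE; apply: I1; rewrite IAE; exact: ring_set1.
Qed.

Lemma star_Max1 M : star_Max star M -> ~ M 1.
Proof.
move=> [[[[Msub _ _] MA] MnA _] _] M1; apply: MnA.
by apply/seteqP; split=> // r Ar; rewrite -[r]mulr1; exact: submoduleM.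
Qed.

Lemma outside1 M : star_Max star M -> outside M 1.
Proof. by move=> MM; split; [exact: ring_set1 | exact: star_Max1]. Qed.

(** Otherwise [conductor T z] is a proper star-ideal containing [M], hence equal to [M], although it
    contains [s]. For T = M this says that [M] is prime. *)
Lemma star_Max_conductor M T z s : star_Max star M -> star_ideal star T ->
  (forall c, M c -> T (c * z)) -> outside M s -> T (s * z) -> T z.
Proof.
move=> MM Tst MT [As Ms] Ts; apply: contrapT => Tz.
have Cprop : proper_integral_star_ideal star (conductor T z).
  apply: proper_star_idealP; first exact: star_ideal_conductor.
    by move=> c [].
  by move=> [_]; rewrite mul1r.
have [_ /(_ _ Cprop) CM] := MM; apply: Ms; rewrite -CM; first by split.
by move=> c Mc; split; [exact: star_Max_ring Mc | exact: MT].
Qed.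

Lemma outsideM M s t : star_Max star M -> outside M s -> outside M t ->
  outside M (s * t).
Proof.
move=> MM Ms [At Mt]; split; first by apply: ring_setM => //; case: Ms.
move=> Mst; apply: Mt; apply: star_Max_conductor (MM) _ _ Ms Mst.
  exact: star_Max_star.
move=> c Mc; rewrite mulrC.
by apply: submoduleM => //; exact/ideal_submodule/star_Max_ideal.
Qed.

Lemma outside_prod M (T : Type) (r : seq T) (P : pred T) (F : T -> {fraction R}) :
  star_Max star M -> (forall i, P i -> outside M (F i)) ->
  outside M (\prod_(i <- r | P i) F i).
Proof.
move=> MM MF; apply: big_ind => //; first exact: outside1.
by move=> s t; exact: outsideM.
Qed.

Lemma outside_neq0 M s : star_Max star M -> outside M s -> s != 0.
Proof.
move=> MM [_ Ms]; apply/eqP => s0; apply: Ms; rewrite s0.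
by have [[]] := star_Max_ideal MM.
Qed.

(** If z is not in T, the ideal [conductor T z] is proper and lies in some star-maximal ideal, which
    then contains the given s. *)
Lemma star_local_global T z : star_ideal star T ->
  (forall M, star_Max star M -> exists2 s, outside M s & T (s * z)) -> T z.
Proof.
move=> Tst Tloc; apply: contrapT => Tz.
have [|M MM CM] := @star_Max_exists (conductor T z); first apply: proper_star_idealP.
- exact: star_ideal_conductor.
- by move=> c [].
- by move=> [_]; rewrite mul1r.
by have [s [As Ms] Ts] := Tloc M MM; apply: Ms; exact: CM.
Qed.

Lemma star_one I : ideal I ->
  (forall M, star_Max star M -> exists2 s, outside M s & I s) -> star I 1.
Proof.
move=> Iid Iloc; apply: star_local_global; first exact: star_ideal_star.
move=> M MM; have [s Ms Is] := Iloc M MM; exists s => //.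
by rewrite mulr1; exact: star_extensive.
Qed.

(** A finite sum of fractions has a common denominator outside [M]. From here on localization is
    handled through this existential form. *)
Lemma localP M I x : star_Max star M -> submodule I ->
  prod_set I (localization M) x <-> exists2 s, outside M s & I (s * x).
Proof.
move=> MM Isub; split; last first.
  move=> [s Ms Isx]; have s0 := outside_neq0 MM Ms.
  have -> : x = (s * x) * s^-1 by rewrite mulrC mulKf.
  apply: prod_set_mul => //; have [[r _ rs] nMs] := Ms.
  by exists 1, r; rewrite rs tofrac1 mul1r.
have [I0 ID _] := Isub.
suff : prod_set I (localization M) `<=`
    [set x | exists2 s, outside M s & I (s * x)] by apply.
apply: prod_set_sub; first split.
- by exists 1; [exact: outside1 | rewrite mulr0].
- move=> y z [s Ms Isy] [t Mt Itz]; exists (s * t); first exact: outsideM.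
  rewrite mulrDr; apply: ID.
    by rewrite mulrAC mulrC; apply: submoduleM => //; have [] := Mt.
  by rewrite -mulrA; apply: submoduleM => //; have [] := Ms.
- move=> r y [s Ms Isy]; exists s => //; rewrite mulrCA.
  by apply: submoduleM => //; exact: ring_setP.
move=> y _ Iy [a [s [Ms ->]]]; have Os : outside M (tofrac s).
  by split=> //; exact: ring_setP.
exists (tofrac s) => //; have s0 := outside_neq0 MM Os.
rewrite mulrC -mulrA divfK // mulrC.
by apply: submoduleM => //; exact: ring_setP.
Qed.

Lemma star_tildeP I x : submodule I -> star_tilde star I x <->
  forall M, star_Max star M -> exists2 s, outside M s & I (s * x).
Proof.
move=> Isub; split=> Ix M MM; first by apply/localP => //; exact: Ix.
by apply/localP => //; exact: Ix.
Qed.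

Lemma star_tilde_sub I : ideal I -> star_tilde star I `<=` star I.
Proof.
move=> Iid x /(star_tildeP _ (ideal_submodule Iid)) Ix.
apply: star_local_global; first exact: star_ideal_star.
move=> M MM; have [s Ms Is] := Ix M MM; exists s => //.
exact: star_extensive.
Qed.

Lemma star_tilde_extensive I : ideal I -> I `<=` star_tilde star I.
Proof.
move=> Iid x Ix; apply/star_tildeP; first exact: ideal_submodule.
by move=> M MM; exists 1; [exact: outside1 | rewrite mul1r].
Qed.

(** The inclusion in [star I] bounds the denominators, also when there is no star-maximal ideal and
    the intersection is the whole field. *)
Lemma star_tilde_ideal I : ideal I -> ideal (star_tilde star I).
Proof.
move=> Iid; have Isub := ideal_submodule Iid; have [I0 ID _] := Isub.
have sIid := star_ideal_closed hstar Iid.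
have [_ [x Ix x0] _] := Iid.
apply: (ideal_sub sIid); last exact: star_tilde_sub.
  split; first exact: star_tilde_extensive.
  - move=> y z /(star_tildeP _ Isub) Iy /(star_tildeP _ Isub) Iz.
    apply/star_tildeP => // M MM.
    have [s Ms Isy] := Iy M MM; have [t Mt Itz] := Iz M MM.
    exists (s * t); first exact: outsideM.
    rewrite mulrDr; apply: ID.
      by rewrite mulrAC mulrC; apply: submoduleM => //; have [] := Mt.
    by rewrite -mulrA; apply: submoduleM => //; have [] := Ms.
  - move=> r y /(star_tildeP _ Isub) Iy; apply/star_tildeP => // M MM.
    have [s Ms Isy] := Iy M MM; exists s => //; rewrite mulrCA.
    by apply: submoduleM => //; exact: ring_setP.
by exists x => //; exact: star_tilde_extensive.
Qed.

Lemma star_tilde_monotone I J : ideal I -> ideal J -> I `<=` J ->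
  star_tilde star I `<=` star_tilde star J.
Proof.
move=> Iid Jid IJ x /(star_tildeP _ (ideal_submodule Iid)) Ix.
apply/star_tildeP; first exact: ideal_submodule.
by move=> M MM; have [s Ms Is] := Ix M MM; exists s => //; exact: IJ.
Qed.

Lemma star_tilde_operation : star_operation (star_tilde star).
Proof.
split.
- exact: star_tilde_ideal.
- apply/seteqP; split; last exact/star_tilde_extensive/ideal_ring.
  by move=> x /(star_tilde_sub (ideal_ring R)); rewrite star_ring.
- move=> a I a0 Iid; have Isub := ideal_submodule Iid.
  have aIsub := ideal_submodule (ideal_scale a0 Iid).
  apply/seteqP; split=> x.
    move=> /(star_tildeP _ aIsub) Ix; apply/scale_setE => //.
    apply/star_tildeP => // M MM; have [s Ms] := Ix M MM.
    by rewrite scale_setE // -mulrA; exists s.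
  rewrite scale_setE // => /(star_tildeP _ Isub) Ix.
  apply/star_tildeP => // M MM; have [s Ms Is] := Ix M MM.
  by exists s => //; rewrite scale_setE // -mulrA.
- exact: star_tilde_extensive.
- exact: star_tilde_monotone.
- move=> I Iid; have Isub := ideal_submodule Iid.
  have tIid := star_tilde_ideal Iid.
  apply/seteqP; split; last exact: star_tilde_extensive.
  move=> x /(star_tildeP _ (ideal_submodule tIid)) Ix.
  apply/star_tildeP => // M MM.
  have [s Ms /(star_tildeP _ Isub) /(_ M MM) [t Mt Its]] := Ix M MM.
  by exists (t * s); [exact: outsideM | rewrite -mulrA].
Qed.

Lemma PstarMD_of_tilde : PstarMD (star_tilde star) -> PstarMD star.
Proof.
move=> pmd I Ifg; have [Iid _] := Ifg.
have Cid := ideal_colon (ideal_ring R) Iid; have ICid := ideal_prod Iid Cid.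
apply: star_full => //.
  apply: prod_set_sub; first exact: ring_set_submodule.
  by move=> x y Ix /colonP Cy; rewrite mulrC; exact: Cy.
by apply: star_tilde_sub => //; rewrite pmd //; exact: ring_set1.
Qed.

(** If I (R : I) were contained in a star-maximal M, so would be its closure, which is [R]. Hence it
    has an element outside every M. *)
Lemma PstarMD_tilde : PstarMD star -> PstarMD (star_tilde star).
Proof.
move=> pmd I Ifg; have [Iid _] := Ifg.
have Cid := ideal_colon (ideal_ring R) Iid; have ICid := ideal_prod Iid Cid.
have ICA : prod_set I (colon A I) `<=` A.
  apply: prod_set_sub; first exact: ring_set_submodule.
  by move=> x y Ix /colonP Cy; rewrite mulrC; exact: Cy.
apply: star_full => //; first exact: star_tilde_operation.
apply/star_tildeP; first exact: ideal_submodule.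
move=> M MM; apply: contrapT => nM; apply: (star_Max1 MM).
apply: (star_sub hstar ICid (star_Max_star MM)); last first.
  by rewrite pmd //; exact: ring_set1.
move=> c Cc; apply: contrapT => Mc; apply: nM; exists c.
  by split=> //; exact: ICA.
by rewrite mulr1.
Qed.

(** Finite type reduces the claim to finitely generated F, and there both closures are [v_op F]. *)
Lemma star_tildeE I : PstarMD star -> ideal I -> star_tilde star I = star I.
Proof.
move=> pmd Iid; apply/seteqP; split; first exact: star_tilde_sub.
move=> x Ix; have [F [Ffg FI]] := star_fg Iid Ix; have [Fid _] := Ffg.
rewrite (PstarMD_v hstar) ?pmd // -(PstarMD_v star_tilde_operation) //.
  exact: star_tilde_monotone.
exact: PstarMD_tilde.
Qed.

Lemma t_opE I : PstarMD star -> ideal I -> t_op I = star I.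
Proof.
move=> pmd Iid; rewrite /t_op hft //; apply: eq_bigcupr => F [Ffg _].
by have [Fid _] := Ffg; rewrite (PstarMD_v hstar) ?pmd.
Qed.

(** [star_tilde] depends on [star] only through the star-maximal ideals, and these are determined by
    the values on ideals, where [star] and [t_op] agree. *)
Lemma star_tilde_w I : PstarMD star -> star_tilde star I = w_op I.
Proof.
move=> pmd; rewrite /w_op /star_tilde.
suff -> : star_Max star = star_Max (@t_op R) by [].
suff E : proper_integral_star_ideal star = proper_integral_star_ideal (@t_op R).
  by rewrite /star_Max E.
apply/funext => J; apply/propext; split=> -[Jint JA [Jid Jst]]; split=> //; split=> //.
  by rewrite t_opE.
by rewrite -t_opE.
Qed.
End FiniteType.

(** * Localization at a star-maximal ideal, the determinant trick and Nakayama's lemma *)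

Section Local.
Variables (R : idomainType) (star : set {fraction R} -> set {fraction R}).
Hypothesis hstar : star_operation star.
Hypothesis hft : finite_type star.
Implicit Types (I J L M S T : set {fraction R}) (x y z c d s : {fraction R}).
Local Notation A := (ring_set R).

Lemma strongly_star_discrete_of_stable : star_stable star -> strongly_star_discrete star.
Proof.
move=> stab P [[[Pid PA] PnA _] Pst] PE; have [_ PS] := Pst.
have Psub := ideal_submodule Pid.
have := stab P Pid; rewrite /ideal_star_stable /= -PS => stE.
(* x P <= (P : P) gives x P^2 <= P, and [P] is the closure of P^2. *)
have CE : colon (colon P P) P `<=` colon P P.
  move=> x /colonP xP; apply/colonP => p; rewrite [X in X p -> _]PE.
  move: p; apply: (star_mull hstar) => //; first exact: ideal_prod.
  suff : prod_set P P `<=` [set c | P (x * c)] by [].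
  have [P0 PD PM] := Psub; apply: prod_set_sub; first split => /=.
  - by rewrite mulr0.
  - by move=> u v /= Pu Pv; rewrite mulrDr; exact: PD.
  - by move=> r u /= Pu; rewrite mulrCA; exact: PM.
  - by move=> u v Pu Pv /=; rewrite mulrA; have /colonP := xP _ Pu; exact.
(* By stability [1] is in the closure of P ((P : P) : P), which [CE] shows to be contained in
   [P]. *)
have P1 : P 1.
  have : colon P P 1 by exact: colon1.
  rewrite -stE; apply: (star_sub hstar) => //.
    by apply: ideal_prod => //; do 2 apply: ideal_colon => //.
  apply: prod_set_sub => // x y Px /CE/colonP yP.
  by rewrite mulrC; exact: yP.
apply: PnA; apply/seteqP; split=> // r Ar; rewrite -[r]mulr1.
exact: submoduleM.
Qed.

(* This is [J R_M], described without denominators as in [localP]. *)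
Definition local M J : set {fraction R} := [set x | exists2 s, outside M s & J (s * x)].

Lemma local_submodule M J : star_Max star M -> submodule J -> submodule (local M J).
Proof.
move=> MM Jsub; have [J0 JD _] := Jsub; split.
- by exists 1; [exact: outside1 MM | rewrite mulr0].
- move=> y z [s Ms Jsy] [t Mt Jtz]; exists (s * t); first exact: (outsideM hstar).
  rewrite mulrDr; apply: JD.
    by rewrite mulrAC mulrC; apply: submoduleM => //; have [] := Mt.
  by rewrite -mulrA; apply: submoduleM => //; have [] := Ms.
- move=> r y [s Ms Jsy]; exists s => //; rewrite mulrCA.
  by apply: submoduleM => //; exact: ring_setP.
Qed.

Lemma local_incl M J : star_Max star M -> J `<=` local M J.
Proof. by move=> MM x Jx; exists 1; [exact: outside1 MM | rewrite mul1r]. Qed.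

Lemma localM M J c x : star_Max star M -> submodule J ->
  local M A c -> local M J x -> local M J (c * x).
Proof.
move=> MM Jsub [s Ms Asc] [t Mt Jtx]; exists (s * t); first exact: (outsideM hstar).
by rewrite mulrACA; exact: submoduleM.
Qed.

Lemma local_fg M J F z : star_Max star M -> submodule J -> fg_ideal F ->
  (forall c, F c -> local M J (z * c)) ->
  exists2 s, outside M s & forall c, F c -> J (s * z * c).
Proof.
move=> MM Jsub [_ [n [g ->]]] Fz; have [J0 JD JM] := Jsub.
have /choice[s sP] : forall i, exists s, outside M s /\ J (s * (z * g i)).
  by move=> i; have [s Ms Js] := Fz _ (span_gen g i); exists s.
exists (\prod_i s i).
  by apply: (outside_prod hstar) => // i _; have [] := sP i.
suff : span g `<=` [set c | J (\prod_i s i * z * c)] by [].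
apply: span_sub; first split => /=.
- by rewrite mulr0.
- by move=> u v /= Ju Jv; rewrite mulrDr; exact: JD.
- by move=> r u /= Ju; rewrite mulrCA; exact: JM.
- move=> i /=; have [_ Js] := sP i; rewrite (bigD1 i) //= -mulrA mulrAC mulrC.
  apply: submoduleM => //.
  by apply: ring_set_prod => j _; have [[]] := sP j.
Qed.

(** Column j of [B] expresses [h j], so that g acts as a row vector, the convention of [eigenvalue].
    The case J = R serves integrality, the case J = M Nakayama's lemma. *)
Lemma span_choice n (g : 'I_n -> {fraction R}) J (h : 'I_n -> {fraction R}) :
  submodule J ->
  (forall i, prod_set J (span g) (h i)) ->
  exists B : 'M_n, (forall i j, J (B i j)) /\ forall j, h j = \sum_i g i * B i j.
Proof.
move=> Jsub hJ; have [J0 JD JM] := Jsub.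
have /choice[b bP] : forall j, exists b : 'I_n -> {fraction R},
    (forall i, J (b i)) /\ h j = \sum_i g i * b i.
  move=> j; have := hJ j; move: (h j) => {hJ h} h hJ.
  have : prod_set J (span g) `<=` [set h | exists b : 'I_n -> {fraction R},
    (forall i, J (b i)) /\ h = \sum_i g i * b i].
    apply: prod_set_sub; first split => /=.
    - by exists (fun=> 0); split=> //; rewrite big1 // => i; rewrite mulr0.
    - move=> _ _ [b [Jb ->]] [b' [Jb' ->]]; exists (fun i => b i + b' i).
      split=> [i|]; first exact: JD.
      by rewrite -big_split; apply: eq_bigr => i _; rewrite mulrDr.
    - move=> r _ [b [Jb ->]]; exists (fun i => tofrac r * b i).
      split=> [i|]; first exact: JM.
      by rewrite mulr_sumr; apply: eq_bigr => i _; rewrite mulrCA.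
    - move=> x _ Jx [c ->]; exists (fun i => tofrac (c i) * x).
      split=> [i|]; first exact: JM.
      by rewrite mulr_sumr; apply: eq_bigr => i _; rewrite mulrA mulrC [x * _]mulrC.
  by apply.
exists (\matrix_(i, j) b j i); split=> [i j|j]; first by rewrite mxE; have [] := bP j.
by have [_ ->] := bP j; apply: eq_bigr => i _; rewrite mxE.
Qed.

Lemma eigenvalue_of_span n (g : 'I_n -> {fraction R}) (B : 'M_n) s :
  (exists i, g i != 0) -> (forall j, s * g j = \sum_i g i * B i j) ->
  eigenvalue B s.
Proof.
move=> [i gi0] sg; apply/eigenvalueP; exists (\row_i g i).
  apply/rowP => j; rewrite !mxE sg; apply: eq_bigr => k _.
  by rewrite mxE.
by apply/eqP => /rowP /(_ i); rewrite !mxE => /eqP; rewrite (negPf gi0).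
Qed.

Lemma span_neq0 n (g : 'I_n -> {fraction R}) : ideal (span g) -> exists i, g i != 0.
Proof.
move=> [_ [_ [c ->] /eqP g0] _]; apply: contrapT => ng; apply: g0.
rewrite big1 // => i _; apply/eqP; rewrite mulf_eq0; apply/orP; right.
by apply: contrapT => gi; apply: ng; exists i; apply/negP.
Qed.

(** Determinant trick: multiplication by s on generators of [F] has a matrix over [R], and s is a
    root of its characteristic polynomial. *)
Lemma integral_of_stabilizer F s : integrally_closed R -> fg_ideal F ->
  (forall c, F c -> F (s * c)) -> A s.
Proof.
move=> icl [Fid [n [g FE]]] sF; apply: icl.
have [B [AB sg]] : exists B : 'M_n, (forall i j, A (B i j)) /\
    forall j, s * g j = \sum_i g i * B i j.
  apply: (@span_choice _ g A) => [|i]; first exact: ring_set_submodule.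
  rewrite -[s * _]mul1r; apply: prod_set_mul; first exact: ring_set1.
  by rewrite -FE; apply: sF; rewrite FE; exact: span_gen.
have /choice[C CP] : forall ij : 'I_n * 'I_n, exists r, tofrac r = B ij.1 ij.2.
  by move=> [i j]; have [r _ rB] := AB i j; exists r.
exists (char_poly (\matrix_(i, j) C (i, j))); first exact: char_poly_monic.
rewrite map_char_poly; have -> : map_mx (tofrac (R:=R)) (\matrix_(i, j) C (i, j)) = B.
  by apply/matrixP => i j; rewrite !mxE CP.
rewrite -eigenvalue_root_char; apply: eigenvalue_of_span sg.
by apply: span_neq0; rewrite -FE.
Qed.

(** If x F is in the tilde closure of F, then s x F <= F for some s outside M; so s x is integral,
    and x lies in every R_M. *)
Lemma tilde_integrally_closed :
  integrally_closed R -> star_integrally_closed (star_tilde star).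
Proof.
move=> icl; have ht := star_tilde_operation hstar hft.
apply: (star_integrally_closedP ht) => F Ffg x.
have [Fid _] := Ffg; have Fsub := ideal_submodule Fid.
rewrite (star_colonr ht) //; last exact: star_ideal_star.
move=> /colonP xF; apply: (star_local_global hstar hft) => [|M MM].
  exact: star_ideal_ring.
have [|s Ms sF] := @local_fg M F F x MM Fsub Ffg.
  by move=> c Fc; have /(star_tildeP hstar _ Fsub) := xF c Fc; exact.
by exists s => //; exact: (integral_of_stabilizer icl Ffg).
Qed.

(** Sums and products respect congruence modulo M among elements of [R]; this is why the relation
    [K] also records membership in [R]. *)
Lemma det_congr M n (B C : 'M[{fraction R}]_n) : ideal M -> M `<=` A ->
  (forall i j, [/\ A (B i j), A (C i j) & M (B i j - C i j)]) ->
  M (\det B - \det C).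
Proof.
move=> Mid MA BC; have Msub := ideal_submodule Mid; have [M0 MD _] := Msub.
pose K u v := [/\ A u, A v & M (u - v)].
suff [_ _ //] : K (\det B) (\det C).
rewrite /determinant; apply: (big_ind2 K) => [|u u' v v' [Au Au' Mu] [Av Av' Mv]|p _].
- by split; [exact: ring_set0 | exact: ring_set0 | rewrite subrr].
- split; [exact: ring_setD | exact: ring_setD |].
  by rewrite opprD addrACA; exact: MD.
have [AP AQ MPQ] : K (\prod_i B i (p i)) (\prod_i C i (p i)).
  apply: (big_ind2 K) => [|u u' v v' [Au Au' Mu] [Av Av' Mv]|i _]; last exact: BC.
  - by split; [exact: ring_set1 | exact: ring_set1 | rewrite subrr].
  split; [exact: ring_setM | exact: ring_setM |].
  have -> : u * v - u' * v' = v * (u - u') + u' * (v - v') by ring.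
  by apply: MD; exact: submoduleM.
have A1 : A ((-1) ^+ p).
  by case: (odd_perm p); rewrite ?expr0 ?expr1; [exact/ring_setN/ring_set1 | exact: ring_set1].
split; [exact: ring_setM | exact: ring_setM |].
by rewrite -mulrBr; exact: submoduleM.
Qed.

(** The relation s F <= M F makes s an eigenvalue of a matrix [B] over M; then det(s - B) = 0 is
    congruent to s^n modulo M, while s^n is outside M. *)
Lemma nakayama M F s : star_Max star M -> fg_ideal F -> outside M s ->
  (forall c, F c -> prod_set M F (s * c)) -> False.
Proof.
move=> MM [Fid [n [g FE]]] [As Ms] sF.
have Mid := star_Max_ideal MM; have Msub := ideal_submodule Mid.
have MA := star_Max_ring MM.
have [B [MB sg]] : exists B : 'M_n, (forall i j, M (B i j)) /\
    forall j, s * g j = \sum_i g i * B i j.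
  apply: (@span_choice _ g M) => // i; rewrite -FE.
  by apply: sF; rewrite FE; exact: span_gen.
have /eigenvalueP[v vB v0] : eigenvalue B s.
  by apply: eigenvalue_of_span sg; apply: span_neq0; rewrite -FE.
have : M (\det (s%:M : 'M_n) - \det (s%:M - B)).
  apply: (@det_congr M) => // i j; have MBij := MB i j.
  have AS : A (s *+ (i == j)) by case: (i == j) => //; exact: ring_set0.
  rewrite !mxE; split=> //.
    by apply: ring_setD => //; apply/ring_setN/MA.
  by rewrite opprB addrCA subrr addr0.
have /eqP -> : \det (s%:M - B) == 0.
  apply/det0P; exists v => //; rewrite mulmxBr vB.
  by rewrite -scalemx1 -scalemxAr mulmx1 subrr.
rewrite subr0 det_scalar.
suff [_ +] : outside M (s ^+ n) by [].
elim: n {g FE B MB sg v vB v0} => [|n IHn]; first by rewrite expr0; exact: outside1 MM.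
by rewrite exprS; apply: (outsideM hstar).
Qed.
End Local.

(* On [{fraction R}] itself the [field] tactic unfolds the quotient
   construction and does not terminate in reasonable time. *)
Section FieldIdentities.
Variable K : fieldType.
Implicit Types b c d h s t w x y z : K.

Lemma mul_div_cancel h x y z : x != 0 -> h * x / y * z / x = h * z / y.
Proof. by move=> x0; have [->|y0] := eqVneq y 0; [rewrite !invr0; ring|field; rewrite x0 y0]. Qed.

Lemma div_mul_div w x y z : y / x * z / w = z / (x * w / y).
Proof. by rewrite invf_div invfM; ring. Qed.

Lemma mul_sq_div s x y c : y != 0 -> s * (x * y / c) = x / y * (s * (y * y / c)).
Proof. by move=> y0; rewrite [RHS]mulrCA -[y * y / c]mulrA !mulrA divfK. Qed.

Lemma iterated_ratio s t x c : c != 0 ->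
  t * s * ((x / c) ^+ 3 * c) = t * (s * (x * x / c) * x / c).
Proof. by move=> c0; field. Qed.

Lemma ratio_product s x y c : [/\ s != 0, x != 0, y != 0 & c != 0] ->
  y / (s * s * (y * y / c)) * (y / (x * x / c) *
    ((s * ((x / c) ^+ 3 * c)) / (x * x / c) * ((s * ((x / c) ^+ 3 * c)) / (x * x / c)))) = 1.
Proof. by move=> [s0 x0 y0 c0]; field; rewrite c0 x0 y0 s0. Qed.

Lemma scaled_ratio d s x y c : d != 0 ->
  s * (x * y / c) = s * ((d * x) * (d * c)^-1) * y.
Proof. by move=> d0; rewrite -mulf_div divff // mul1r; ring. Qed.
End FieldIdentities.

(** * P*MDs: the valuation rings R_M, strong discreteness, and stability *)

Section PstarMDTheory.
Variables (R : idomainType) (star : set {fraction R} -> set {fraction R}).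
Hypothesis hstar : star_operation star.
Hypothesis hft : finite_type star.
Hypothesis pmd : PstarMD star.
Implicit Types (I J L M N S T : set {fraction R}) (x y z c d s u : {fraction R}).
Local Notation A := (ring_set R).
Local Notation star_Max := (star_Max star).

(** Let F = (1, u). If neither u nor u^-1 is in R_M, every k in (R : F) has both k and k u in [M],
    so F (R : F) <= M, against the invertibility of [F]. *)
Lemma local_valuation M u : star_Max M -> local M A u \/ local M A u^-1.
Proof.
move=> MM; have Mst := star_Max_star MM; have Mid := star_Max_ideal MM.
have [F [Ffg F1 Fu Fmin]] := fg_pair u (oner_neq0 {fraction R}).
have [Fid _] := Ffg; have Cid := ideal_colon (ideal_ring R) Fid.
apply: contrapT => /not_orP[nu nuV]; apply: (star_Max1 MM).
suff FCM : prod_set F (colon A F) `<=` M.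
  apply: (star_sub hstar _ Mst FCM); first exact: ideal_prod.
  exact: fg_integral_inverse.
have Msub := ideal_submodule Mid; have [M0 MD MZ] := Msub.
apply: prod_set_sub => // f k + /colonP kF; move: f.
have Ak : A k by rewrite -[k]mulr1; exact: kF.
have Mk : M k by apply: contrapT => Mk; apply: nu; exists k => //; exact: kF.
suff : F `<=` [set f | M (f * k)] by [].
apply: Fmin => /=; first split => /=.
- by rewrite mul0r.
- by move=> x y /= Mx My; rewrite mulrDl; exact: MD.
- by move=> r x /= Mx; rewrite -mulrA; exact: MZ.
- by rewrite mul1r.
have [->|u0] := eqVneq u 0; first by rewrite mul0r.
rewrite mulrC; apply: contrapT => Mku; apply: nuV; exists (k * u).
  by split=> //; exact: kF.
by rewrite mulfK.
Qed.

Lemma local_nonunit M u : star_Max M -> u != 0 -> ~ local M A u ->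
  local M M u^-1.
Proof.
move=> MM u0 nu; have [|[s Ms Asu]] := local_valuation u MM; first by [].
exists s => //; apply: contrapT => Msu; apply: nu; exists (s / u) => //.
by rewrite divfK //; have [] := Ms.
Qed.

Lemma local_max1 M : star_Max M -> ~ local M M 1.
Proof. by move=> MM [s [_ Ms]]; rewrite mulr1. Qed.

(** If z / w were in R_M, then z = (z / w) w would be in [T]; so in the valuation ring R_M the
    inverse w / z is a nonunit. *)
Lemma local_divides M T w z : star_Max M ->
  (forall c x, local M A c -> T x -> T (c * x)) ->
  T w -> ~ T z -> local M M (w / z).
Proof.
move=> MM TV Tw Tz; have Msub := ideal_submodule (star_Max_ideal MM).
have [w0|w0] := eqVneq w 0.
  by rewrite w0 mul0r; have [] := local_submodule hstar MM Msub.
have z0 : z != 0.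
  apply: contra_notN Tz => /eqP ->; rewrite -[0](mul0r w); apply: TV => //.
  by have [] := local_submodule hstar MM (ring_set_submodule R).
rewrite -invf_div; apply: local_nonunit => //.
  by rewrite mulf_neq0 // invr_eq0.
by move=> Vzw; apply: Tz; rewrite -(divfK w0 z); exact: TV.
Qed.

Lemma local_max_mul M x y : star_Max M -> local M M x ->
  local M M y -> local M M (x * y).
Proof.
move=> MM [s Ms Msx] My; apply: (localM hstar) => //.
  exact: ideal_submodule (star_Max_ideal MM).
by exists s => //; exact: (star_Max_ring MM).
Qed.

Lemma local_ring M x : star_Max M -> A x -> local M A x.
Proof. by move=> MM; exact: (local_incl MM). Qed.

Lemma local_inv M s : star_Max M -> outside M s -> local M A s^-1.
Proof.
move=> MM Ms; exists s => //; rewrite divff; first exact: ring_set1.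
exact: (outside_neq0 MM Ms).
Qed.

(* An idempotent proper submodule [L] of [R_M] is a prime ideal of the
   valuation ring [R_M], and [L `&` R] is then an idempotent star-prime. *)
Lemma no_local_idempotent M L : strongly_star_discrete star -> star_Max M ->
  submodule L -> (forall c x, local M A c -> L x -> L (c * x)) ->
  (exists2 x, L x & x != 0) -> L `<=` prod_set L L -> ~ L 1 -> False.
Proof.
move=> disc MM Lsub LV [l Ll l0] LL L1; have [L0 LD LM] := Lsub.
have Mid := star_Max_ideal MM; have Msub := ideal_submodule Mid.
pose P := L `&` A.
have PM : P `<=` M.
  move=> x [Lx Ax]; apply: contrapT => Mx; apply: L1.
  have Ox : outside M x by [].
  rewrite -(mulVf (outside_neq0 MM Ox)); apply: LV => //.
  exact: local_inv.
have Psub : submodule P.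
  split; first by split => //; exact: ring_set0.
  - by move=> x y [Lx Ax] [Ly Ay]; split; [exact: LD | exact: ring_setD].
  - by move=> r x [Lx Ax]; split; [exact: LM | apply: ring_setM => //; exact: ring_setP].
(* An element of [L] outside R_M would have its inverse in R_M, and [1] would be in [L]. *)
have Vl x : L x -> local M A x.
  move=> Lx; have [x0|x0] := eqVneq x 0.
    by rewrite x0; apply: local_ring => //; exact: ring_set0.
  have [//|Vx] := local_valuation x MM.
  by case: L1; rewrite -(mulVf x0); exact: LV.
have LP x : L x -> exists2 s, outside M s & P (s * x).
  move=> Lx; have [s Ms As] := Vl x Lx; exists s => //; split=> //.
  by apply: submoduleM => //; have [] := Ms.
have Pid : ideal P.
  apply: (ideal_sub (ideal_ring R)) => // [|x []//].
  have [s Ms Ps] := LP _ Ll; exists (s * l) => //.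
  by rewrite mulf_neq0 // (outside_neq0 MM Ms).
have Pst : star_ideal star P.
  split=> //; apply/seteqP; split; first exact: (star_extensive hstar).
  move=> x Px; split; last first.
    by apply: (star_sub hstar Pid _ _ Px); [exact: star_ideal_ring | move=> y []].
  move: Px; rewrite -(star_tildeE hstar hft) // => /(star_tildeP hstar _ Psub) /(_ M MM).
  move=> [s Ms [Ls _]]; rewrite -(mulKf (outside_neq0 MM Ms) x).
  by apply: LV => //; exact: local_inv.
(* If a and b are outside [L], then L^2 <= a b M R_M; as a b is in L <= L^2, this puts [1] in M
   R_M. *)
have Pprime a b : A a -> A b -> P (a * b) -> P a \/ P b.
  move=> Aa Ab [Lab _]; apply: contrapT => /not_orP[Pa Pb].
  have La : ~ L a by move=> La; apply: Pa.
  have Lb : ~ L b by move=> Lb; apply: Pb.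
  have a0 : a != 0 by apply: contra_notN La => /eqP ->.
  have b0 : b != 0 by apply: contra_notN Lb => /eqP ->.
  apply: (local_max1 MM); rewrite -(divff (mulf_neq0 a0 b0)).
  have [K0 KD KM] := local_submodule hstar MM Msub.
  suff : prod_set L L `<=` [set z | local M M (z / (a * b))] by apply; exact: LL.
  apply: prod_set_sub; first split => /=.
  - by rewrite mul0r.
  - by move=> x y /= Kx Ky; rewrite mulrDl; exact: KD.
  - by move=> r x /= Kx; rewrite -mulrA; exact: KM.
  - move=> x y Lx Ly /=; rewrite invfM mulrACA; apply: local_max_mul => //.
      exact: (local_divides MM LV).
    exact: (local_divides MM LV).
apply: (disc P).
  split=> //; split.
  - by split=> // x [].
  - by move=> PE; apply: (star_Max1 MM); apply: PM; rewrite PE; exact: ring_set1.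
  - by move=> a b; rewrite tofracM; apply: Pprime; exact: ring_setP.
have PPid := ideal_prod Pid Pid; have PPsub := ideal_submodule PPid.
apply/seteqP; split; last first.
  apply: (star_sub hstar) => //; apply: prod_set_sub => // x y Px [_ Ay].
  by rewrite mulrC; exact: submoduleM.
(* Locally at N: if [P] is not in N, an element q of [P] outside N has q p in P^2; otherwise s p is
   in P^2 for some s outside M, and s is divided out in R_N. *)
move=> p Pp; apply: (star_local_global hstar hft); first exact: (star_ideal_star hstar).
move=> N NN.
have [PN|/existsNP[q /not_implyP[Pq Nq]]] := pselect (forall q, P q -> N q); last first.
  exists q; first by split=> //; case: Pq.
  by apply: (star_extensive hstar) => //; exact: prod_set_mul.
suff [t Nt PPt] : local N (prod_set P P) p.
  by exists t => //; exact: (star_extensive hstar).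
have [s Ms PPs] : local M (prod_set P P) p.
  have : prod_set L L `<=` local M (prod_set P P).
    apply: prod_set_sub; first exact: (local_submodule hstar MM).
    move=> x y /LP[s Ms Ps] /LP[t Mt Pt]; exists (s * t); first exact: (outsideM hstar).
    by rewrite mulrACA; exact: prod_set_mul.
  by apply; apply: LL; case: Pp.
have Ps : ~ P s by move=> /PM; case: Ms.
have s0 := outside_neq0 MM Ms.
(* Let q be nonzero. As [P] is prime, contained in N and without s, the quotient s / q is not in
   R_N; so q / s is, and it even lies in P R_N. *)
have divs q : P q -> exists2 t, outside N t & P (t * (q / s)).
  move=> Pq; have [t Nt At] : local N A (q / s).
    have [q0|q0] := eqVneq q 0.
      by rewrite q0 mul0r; apply: local_ring => //; exact: ring_set0.
    have [//|[t Nt At]] := local_valuation (q / s) NN.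
    have : P (t * s).
      have -> : t * s = (t / (q / s)) * q by rewrite invf_div mulrA divfK.
      exact: submoduleM.
    move=> /Pprime[||Pt|//]; [by case: Nt | by case: Ms |].
    by case: Nt => _ []; exact: PN.
  exists t => //; have : P (t * (q / s) * s).
    by rewrite -mulrA divfK //; apply: submoduleM => //; case: Nt.
  by move=> /Pprime[||//|//] //; case: Ms.
have [K0 KD KM] := local_submodule hstar NN PPsub.
have : prod_set P P `<=` [set z | local N (prod_set P P) (z / s)].
  apply: prod_set_sub; first split => /=.
  - by rewrite mul0r.
  - by move=> x y /= Kx Ky; rewrite mulrDl; exact: KD.
  - by move=> r x /= Kx; rewrite -mulrA; exact: KM.
  - move=> x y Px Py /=; have [t Nt Pt] := divs x Px; exists t => //.
    by rewrite mulrAC mulrA; exact: prod_set_mul.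
by move=> /(_ _ PPs) /=; rewrite mulrC mulKf.
Qed.

(** The closure of S (E : S) is an E-module contained in E = (S : S), so it is E as soon as it
    contains [1]. *)
Lemma stable_of_one I : ideal I ->
  let S := star I in star (prod_set S (colon (colon S S) S)) 1 ->
  ideal_star_stable star I.
Proof.
move=> Iid S one; rewrite /ideal_star_stable /= -/S.
have Sst : star_ideal star S by exact: (star_ideal_star hstar).
have [Sid _] := Sst; have Eid := ideal_colon Sid Sid.
have Cid := ideal_colon Eid Sid; have SCid := ideal_prod Sid Cid.
apply/seteqP; split.
  apply: (star_sub hstar) => //; first exact: star_ideal_colon.
  apply: prod_set_sub; first exact: ideal_submodule.
  by move=> x y Sx /colonP yS; rewrite mulrC; exact: yS.
move=> e Ee; apply: (star_cancel hstar SCid) => //; first exact: (star_ideal_star hstar).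
have SCsub := ideal_submodule (star_ideal_closed hstar SCid).
have [K0 KD KM] := SCsub.
suff : prod_set S (colon (colon S S) S) `<=`
  [set z | star (prod_set S (colon (colon S S) S)) (e * z)] by [].
apply: prod_set_sub; first split => /=.
- by rewrite mulr0.
- by move=> x y /= Kx Ky; rewrite mulrDr; exact: KD.
- by move=> r x /= Kx; rewrite mulrCA; exact: KM.
- move=> x y Sx Cy /=; rewrite mulrA; apply: (star_extensive hstar) => //.
  by apply: prod_set_mul => //; have /colonP := Ee; exact.
Qed.

(** The conclusion says that c generates I R_M over (I R_M : I R_M). Without such a c, the maximal
    ideal of that ring would be idempotent, against strong discreteness. *)
Lemma local_principal M I : strongly_star_discrete star -> star_Max M -> ideal I ->
  exists c, [/\ I c, c != 0 & forall x y, I x -> I y -> local M I (x * y / c)].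
Proof.
move=> disc MM Iid; have Isub := ideal_submodule Iid.
have Mid := star_Max_ideal MM; have Msub := ideal_submodule Mid.
have Wsub := local_submodule hstar MM Isub.
have WV c x : local M A c -> local M I x -> local M I (c * x).
  exact: (localM hstar MM Isub).
have mVsub := local_submodule hstar MM Msub; have [m0 mD mZ] := mVsub.
have mV c x : local M A c -> local M M x -> local M M (c * x).
  exact: (localM hstar MM Msub).
apply: contrapT => nopr.
(* The maximal ideal of the valuation ring [(I R_M : I R_M)]. *)
pose Q := [set h | exists y, [/\ local M I y, y != 0 &
  forall x, local M I x -> local M M (h * x / y)]].
have [a [Aa a0 Ia]] := ideal_integral_elt Iid.
have Wa : local M I a by exact: (local_incl MM).
have QV c x : local M A c -> Q x -> Q (c * x).
  move=> Vc [y [Wy y0 Qy]]; exists y; split=> // z Wz.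
  by rewrite -!mulrA; apply: mV => //; rewrite mulrA; exact: Qy.
apply: (@no_local_idempotent M Q) => //.
- split.
  + by exists a; split=> // x _; rewrite !mul0r.
  (* Of two witnesses, the one dividing the other in R_M serves both terms. *)
  + suff QD x y x' y' : local M I y -> y != 0 -> y' != 0 ->
      local M A (y' / y) -> local M I y' ->
      (forall z, local M I z -> local M M (x * z / y)) ->
      (forall z, local M I z -> local M M (x' * z / y')) -> Q (x + x').
      move=> x x' [y [Wy y0 Qy]] [y' [Wy' y'0 Qy']].
      have [V|] := local_valuation (y' / y) MM; first exact: QD V _ _ _.
      by rewrite invf_div addrC => V; exact: QD V _ _ _.
    move=> Wy y0 y'0 V Wy' Qy Qy'; exists y; split=> // z Wz.
    rewrite !mulrDl; apply: mD; first exact: Qy.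
    have -> : x' * z / y = (y' / y) * (x' * z / y') by rewrite [RHS]mulrC mulrA divfK.
    by apply: mV => //; exact: Qy'.
  + by move=> r x; apply: QV; apply: local_ring => //; exact: ring_setP.
- have [m [Am m_0 Mm]] := ideal_integral_elt Mid.
  have [d [Ad d0 dI]] := ideal_bounded Iid.
  exists (m * a * d); last by rewrite !mulf_neq0.
  exists a; split=> // x [s Ms Isx].
  have -> : m * a * d * x / a = d * x * m.
    by rewrite mulrC -!mulrA mulrCA mulKf // mulrC mulrA.
  exists s => //; rewrite mulrA; apply: submoduleM => //.
  by rewrite mulrCA; exact: dI.
- move=> h [y [Wy y0 Qy]].
  (* Up to the unit s of R_M, y is an element of [I]; the failure of the claim for it gives x and w
     with x w / y outside I R_M. *)
  have [x [w [Wx Ww Wxw]]] : exists x w, [/\ local M I x, local M I w &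
      ~ local M I (x * w / y)].
    apply: contrapT => nW; have [s Ms Isy] := Wy; apply: nopr; exists (s * y).
    have s0 := outside_neq0 MM Ms.
    split=> //; first by rewrite mulf_neq0.
    move=> x w Ix Iw; rewrite invfM mulrCA; apply: WV; first exact: local_inv.
    by apply: contrapT => Wxw; apply: nW; exists x, w; split=> //;
      exact: (local_incl MM).
  have W0 : local M I 0 by have [] := Wsub.
  have x0 : x != 0 by apply: contra_notN Wxw => /eqP ->; rewrite !mul0r.
  have w0 : w != 0 by apply: contra_notN Wxw => /eqP ->; rewrite mulr0 mul0r.
  (* Both factors are in [Q], with witnesses x and w: (h x / y) z / x = h z / y, and (y / x) z / w =
     z / (x w / y) is a nonunit because x w / y is not in I R_M. *)
  have -> : h = (h * x / y) * (y / x) by rewrite mulrA divfK // mulfK.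
  apply: prod_set_mul.
    exists x; split=> // z Wz; have -> : h * x / y * z / x = h * z / y.
      exact: mul_div_cancel.
    exact: Qy.
  exists w; split=> // z Wz; have -> : y / x * z / w = z / (x * w / y).
    exact: div_mul_div.
  exact: (local_divides MM WV).
- move=> [y [Wy y0 /(_ _ Wy)]]; rewrite mul1r divff //.
  exact: local_max1.
Qed.

(** If every s failed, s = 1 would give x, and s^2, for s a denominator of x^3 / c^2 at M, would
    give y; the two are incompatible in the valuation ring R_N. *)
Lemma local_comparison M N I c : star_Max M -> star_Max N -> submodule I ->
  I c -> c != 0 -> (forall x y, I x -> I y -> local M I (x * y / c)) ->
  exists2 s, outside M s & forall x y, I x -> I y -> local N I (s * (x * y / c)).
Proof.
move=> MM NN Isub Ic c0 Mc; apply: contrapT => nos.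
have [I0 _ _] := Isub.
have WV b x : local N A b -> local N I x -> local N I (b * x).
  exact: (localM hstar NN Isub).
have W0 : local N I 0 by exact: (local_incl NN).
(* Squares suffice: when x / y is in R_N, x y is the multiple (x / y) y^2. *)
have nosq s : outside M s -> exists2 y, I y & ~ local N I (s * (y * y / c)).
  move=> Ms; apply: contrapT => nosq; apply: nos; exists s => //.
  suff sq x y : I x -> I y -> local N A (x / y) -> local N I (s * (x * y / c)).
    move=> x y Ix Iy; have [V|] := local_valuation (x / y) NN; first exact: sq.
    by rewrite invf_div [x * y]mulrC => V; exact: sq.
  move=> Ix Iy V; have [->|y0] := eqVneq y 0; first by rewrite mulr0 mul0r mulr0.
  have -> : s * (x * y / c) = x / y * (s * (y * y / c)) by exact: mul_sq_div.
  by apply: WV => //; apply: contrapT => Wy; apply: nosq; exists y.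
have [x Ix nWx] := nosq 1 (outside1 MM); rewrite mul1r in nWx.
have x0 : x != 0 by apply: contra_notN nWx => /eqP ->; rewrite mulr0 mul0r.
pose u := x / c; have u0 : u != 0 by rewrite mulf_neq0 // invr_eq0.
(* Applying the bound at M twice puts u^3 c = x^3 / c^2 in I R_M. *)
have [s Ms Isu] : exists2 s, outside M s & I (s * (u ^+ 3 * c)).
  have [s Ms Is] := Mc _ _ Ix Ix; have [t Mt It] := Mc _ _ Is Ix.
  exists (t * s); first exact: (outsideM hstar).
  by rewrite iterated_ratio.
have s0 := outside_neq0 MM Ms.
have [y Iy nWy] := nosq (s * s) (outsideM hstar MM Ms Ms).
have y0 : y != 0 by apply: contra_notN nWy => /eqP ->; rewrite mulr0 mul0r mulr0.
have Wincl z : I z -> local N I z by exact: (local_incl NN).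
(* [s u], [y / (u^2 c)] and [c / (s^2 y)] all lie in the maximal ideal of [R_N],
   but the product of the last two with [(s u)^2] is [1]. *)
have m1 := local_divides NN WV (Wincl _ Isu) nWx.
have m2 := local_divides NN WV (Wincl _ Iy) nWx.
have m3 := local_divides NN WV (Wincl _ Iy) nWy.
apply: (local_max1 NN).
have -> : 1 = y / (s * s * (y * y / c)) * (y / (x * x / c) *
    ((s * (u ^+ 3 * c)) / (x * x / c) * ((s * (u ^+ 3 * c)) / (x * x / c)))).
  by rewrite ratio_product.
by do !apply: local_max_mul => //.
Qed.

Lemma outside_seq M (r : seq (set {fraction R}))
    (P : set {fraction R} -> {fraction R} -> Prop) : star_Max M ->
  (forall N s t, A s -> P N t -> P N (s * t)) ->
  (forall N, N \in r -> exists2 s, outside M s & P N s) ->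
  exists2 s, outside M s & forall N, N \in r -> P N s.
Proof.
move=> MM PM; elim: r => [|N r IHr] rP; first by exists 1; first exact: (outside1 MM).
have [|s Ms Ps] := IHr; first by move=> N' Nr; apply: rP; rewrite inE Nr orbT.
have [|t Mt Pt] := rP N; first by rewrite inE eqxx.
exists (s * t); first exact: (outsideM hstar).
move=> N'; rewrite inE => /orP[/eqP ->|Nr]; first by apply: PM => //; case: Ms.
by rewrite mulrC; apply: PM; [case: Mt | exact: Ps].
Qed.

Lemma stable_of_discrete : strongly_star_discrete star ->
  star_finite_character star -> star_stable star.
Proof.
move=> disc fc I Iid; apply: stable_of_one => //.
set S := star I; have Sst : star_ideal star S by exact: (star_ideal_star hstar).
have [Sid _] := Sst; have Ssub := ideal_submodule Sid.
have Eid := ideal_colon Sid Sid; have Cid := ideal_colon Eid Sid.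
have EA : A `<=` colon S S by exact: ring_set_colon.
apply: (star_one hstar hft) => [|M MM]; first exact: ideal_prod.
have [c [Sc c0 Mc]] := local_principal disc MM Sid.
(* The element b = d c of [R] is nonzero, and only the star-maximal N containing it matter: at the
   others d c is a unit of R_N, while d x is in [R]. *)
have [d [Ad d0 dS]] := ideal_bounded Sid.
have [b _ bE] := dS _ Sc.
have b0 : b != 0 by rewrite -tofrac_eq0 bE mulf_neq0.
have /finite_seqP[r rE] := fc b b0.
pose P N s := forall x y, S x -> S y -> local N S (s * (x * y / c)).
have [|N|s Ms Ps] := @outside_seq M r (fun N s => star_Max N -> P N s) MM.
- move=> N s t As Pt NN x y Sx Sy; rewrite -mulrA.
  by apply: (localM hstar) => //; [exact: local_ring | exact: Pt].
- have [NN _|nN] := pselect (star_Max N); last by exists 1; [exact: (outside1 MM) |].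
  have [s Ms Ps] := local_comparison MM NN Ssub Sc c0 Mc.
  by exists s.
have {}Ps N : star_Max N -> P N s.
  move=> NN; have [Nb|Nb] := pselect (N (tofrac b)).
    by apply: Ps => //; have : [set` r] N by rewrite -rE.
  have Ob : outside N (tofrac b) by split=> //; exact: ring_setP.
  move=> x y Sx Sy; have -> : s * (x * y / c) = s * ((d * x) * (tofrac b)^-1) * y.
    by rewrite bE; exact: scaled_ratio.
  apply: (localM hstar) => //; last exact: (local_incl NN).
  apply: (localM hstar) => //; first exact: ring_set_submodule.
    by apply: local_ring => //; case: Ms.
  apply: (localM hstar) => //; first exact: ring_set_submodule.
    by apply: local_ring => //; exact: dS.
  exact: local_inv.
exists s => //; have -> : s = c * (s / c) by rewrite mulrC divfK.
apply: prod_set_mul => //; apply/colonP => x Sx; apply/colonP => y Sy.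
apply: (star_local_global hstar hft) => // N NN.
have -> : s / c * x * y = s * (x * y / c) by rewrite -!mulrA [c^-1 * _]mulrC !mulrA.
exact: Ps.
Qed.

(** J = (E : S) works: J S <= E gives I^2 J <= S, and I J, whose closure E contains [1], can be
    cancelled from I (I J). *)
Lemma clifford_of_stable : star_stable star -> clifford_star_regular star.
Proof.
move=> stab I Iid; have := stab I Iid; rewrite /ideal_star_stable /=.
set S := star I; have Sst : star_ideal star S by exact: (star_ideal_star hstar).
have [Sid _] := Sst; have Ssub := ideal_submodule Sid.
have Eid := ideal_colon Sid Sid; have Cid := ideal_colon Eid Sid.
move: Eid Cid; set E := colon S S; set J := colon E S => Eid Jid SJE.
exists J => //; have IIid := ideal_prod Iid Iid; have IIJid := ideal_prod IIid Jid.
have IS : I `<=` S by exact: (star_extensive hstar).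
apply/seteqP; split; last first.
  apply: (star_sub hstar) => //.
  rewrite (prod_setC _ J); apply: prod_set_sub => // j z /colonP Jj [n [x [y [xy ->]]]].
  rewrite mulr_sumr; apply: submodule_sum => // i _; rewrite mulrA.
  by have [/IS Sx /IS Sy] := xy i; have /colonP := Jj _ Sx; apply.
apply: (star_sub hstar) => //; first exact: (star_ideal_star hstar).
move=> x Ix; apply: (star_cancel hstar (ideal_prod Iid Jid)).
- by rewrite -(star_prodl hstar) // SJE; exact: colon1.
- exact: (star_ideal_star hstar).
move=> _ [n [y [z [yz ->]]]]; apply: (star_extensive hstar) => //; rewrite mulr_sumr.
apply: submodule_sum; first exact: ideal_submodule.
move=> i _; have [Iy Jz] := yz i; rewrite mulrA.
by do 2 apply: prod_set_mul => //.
Qed.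

(** The regularity identity gives J <= (E : S), so for L the closure of S (E : S), [S] is in the
    closure of S L and L in that of L^2. If [1] were not in L, some L R_M would be proper and
    idempotent. *)
Lemma stable_of_clifford : strongly_star_discrete star ->
  clifford_star_regular star -> star_stable star.
Proof.
move=> disc reg I Iid; apply: stable_of_one => //.
have [J Jid SE] := reg I Iid; move: SE.
set S := star I => SE; have Sst : star_ideal star S by exact: (star_ideal_star hstar).
have [Sid _] := Sst; have Ssub := ideal_submodule Sid.
have Eid := ideal_colon Sid Sid; have Cid := ideal_colon Eid Sid.
move: Eid Cid; set E := colon S S; set C := colon E S => Eid Cid.
have SCid := ideal_prod Sid Cid; set L := star (prod_set S C).
have Lst : star_ideal star L by exact: (star_ideal_star hstar).
have [Lid _] := Lst; have Lsub := ideal_submodule Lid.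
have LLid := ideal_prod Lid Lid; have SLid := ideal_prod Sid Lid.
have JC : J `<=` C.
  move=> j Jj; apply/colonP => x Sx; apply/colonP; move: x Sx.
  suff IIS x y : I x -> I y -> S (j * x * y).
    move=> x Sx; apply: (star_mull hstar Iid Sst) => y Iy; rewrite mulrAC.
    by apply: (star_mull hstar Iid Sst _ Sx) => z Iz; rewrite mulrAC; exact: IIS.
  move=> Ix Iy; rewrite SE; apply: (star_extensive hstar).
  - by apply: ideal_prod => //; exact: ideal_prod.
  - by rewrite -mulrA mulrC; do 2 apply: prod_set_mul => //.
have SSL : S `<=` star (prod_set S L).
  rewrite {1}SE; apply: (star_sub hstar).
  - by apply: ideal_prod => //; exact: ideal_prod.
  - exact: (star_ideal_star hstar).
  apply: prod_set_sub; first exact/ideal_submodule/(star_ideal_closed hstar).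
  move=> z j [n [x [y [xy ->]]]] Jj; rewrite mulr_suml; apply: submodule_sum.
    exact/ideal_submodule/(star_ideal_closed hstar).
  move=> i _; have [Ix Iy] := xy i; rewrite -mulrA; apply: (star_extensive hstar) => //.
  apply: prod_set_mul; first exact: (star_extensive hstar).
  apply: (star_extensive hstar) => //; apply: prod_set_mul; last exact: JC.
  exact: (star_extensive hstar).
have LLL : L `<=` star (prod_set L L).
  apply: (star_sub hstar) => //; first exact: (star_ideal_star hstar).
  apply: prod_set_sub; first exact/ideal_submodule/(star_ideal_closed hstar).
  move=> x c /SSL Sx Cc; rewrite mulrC.
  apply: (star_mull hstar SLid) Sx; first exact: (star_ideal_star hstar).
  move=> _ [n [u [v [uv ->]]]]; rewrite mulr_sumr; apply: submodule_sum.
    exact/ideal_submodule/(star_ideal_closed hstar).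
  move=> i _; have [Su Lv] := uv i; rewrite mulrA [c * _]mulrC.
  apply: (star_extensive hstar) => //; apply: prod_set_mul => //.
  by apply: (star_extensive hstar) => //; exact: prod_set_mul.
apply: contrapT => nL1.
have [M MM nM] : exists2 M, star_Max M & ~ local M L 1.
  apply: contrapT => nM; apply: nL1; apply: (star_local_global hstar hft) => // M MM.
  by apply: contrapT => nLM; apply: nM; exists M.
have LV c x : local M A c -> local M L x -> local M L (c * x).
  exact: (localM hstar MM Lsub).
apply: (@no_local_idempotent M (local M L)) => //.
- exact: (local_submodule hstar MM).
- by have [_ [x Lx x0] _] := Lid; exists x => //; exact: (local_incl MM).
move=> x [s Ms /LLL]; rewrite -(star_tildeE hstar hft) //.
move=> /(star_tildeP hstar _ (ideal_submodule LLid)) /(_ M MM) [t Mt].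
rewrite mulrA => -[n [u [v [uv]]]].
have O := outsideM hstar MM Mt Ms.
move/(canRL (mulKf (outside_neq0 MM O))) ->.
exists n, (fun i => (t * s)^-1 * u i), v; split.
  move=> i; have [Lu Lv] := uv i; split; last exact: (local_incl MM).
  by apply: LV; [exact: local_inv | exact: (local_incl MM)].
by rewrite mulr_sumr; apply: eq_bigr => i _; rewrite mulrA.
Qed.
End PstarMDTheory.

(** * Clifford regularity and the P*MD property *)

Lemma PstarMD_of_clifford (R : idomainType)
    (star : set {fraction R} -> set {fraction R}) :
  star_operation star -> finite_type star -> integrally_closed R ->
  clifford_star_regular (star_tilde star) -> PstarMD star.
Proof.
move=> hstar hft icl reg; apply: PstarMD_of_tilde => // I Ifg.
have ht := star_tilde_operation hstar hft.
have [Iid _] := Ifg; have Isub := ideal_submodule Iid.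
have [J Jid SE] := reg I Iid.
have IIid := ideal_prod Iid Iid; have IIJid := ideal_prod IIid Jid.
(* x y I <= I^2 J puts x y in the endomorphism ring of the tilde closure of [I], which is in [R]
   because [R] is integrally closed. *)
have IJA x y : I x -> J y -> ring_set R (x * y).
  move=> Ix Jy; apply: (star_integral_colon (tilde_integrally_closed hstar hft icl) Ifg).
  rewrite (star_colonr ht) //; last exact: star_ideal_star.
  apply/colonP => z Iz; rewrite SE; apply: star_tilde_extensive => //.
  by rewrite mulrAC; do 2 apply: prod_set_mul => //.
have Cid := ideal_colon (ideal_ring R) Iid; have ICid := ideal_prod Iid Cid.
apply: (star_full ht) => //.
  apply: prod_set_sub; first exact: ring_set_submodule.
  by move=> x y Ix /colonP Cy; rewrite mulrC; exact: Cy.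
apply/(star_tildeP hstar) => [|M MM]; first exact: ideal_submodule.
apply: contrapT => nM.
(* By [IJA], J <= (R : I); so an element of I J outside M would be an element of I (R : I) outside
   M. *)
have IJM x y : I x -> J y -> M (x * y).
  move=> Ix Jy; apply: contrapT => Mxy; apply: nM; exists (x * y).
    by split=> //; exact: IJA.
  rewrite mulr1; apply: prod_set_mul => //; apply/colonP => z Iz.
  by rewrite mulrC; exact: IJA.
(* [I] is in the tilde closure of I^2 J, so s I <= I^2 J <= M I for some s outside M, against
   Nakayama's lemma. *)
have [|s Ms sI] := @local_fg _ _ hstar M _ I 1 MM (ideal_submodule IIJid) Ifg.
  move=> c Ic; have : star_tilde star I c by exact: star_tilde_extensive.
  by rewrite SE mul1r => /(star_tildeP hstar _ (ideal_submodule IIJid)); exact.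
apply: (nakayama hstar MM Ifg Ms) => c Ic.
have := sI c Ic; rewrite mulr1.
have Mid := star_Max_ideal MM.
apply: prod_set_sub; first exact/prod_set_submodule/ideal_submodule.
move=> z j [n [x [y [xy ->]]]] Jj; rewrite mulr_suml; apply: submodule_sum.
  exact/prod_set_submodule/ideal_submodule.
move=> i _; have [Ix Iy] := xy i; rewrite mulrAC.
by apply: prod_set_mul => //; exact: IJM.
Qed.

(** * Stability and finite character: products of star-maximal ideals *)

Section FiniteCharacter.
Variables (R : idomainType) (star : set {fraction R} -> set {fraction R}).
Hypothesis hstar : star_operation star.
Hypothesis hft : finite_type star.
Hypothesis pmd : PstarMD star.
Hypothesis stab : star_stable star.
Implicit Types (I J L M N S T : set {fraction R}) (x y z c d s u : {fraction R}).
Local Notation A := (ring_set R).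
Local Notation star_Max := (star_Max star).
Local Notation invertible I := (star (prod_set I (colon A I)) 1).

Lemma star_Max_invertible M : star_Max M -> invertible M.
Proof.
move=> MM; have Mst := star_Max_star MM; have Mid := star_Max_ideal MM.
have MA := star_Max_ring MM; have Msub := ideal_submodule Mid.
have MCid := ideal_prod Mid (ideal_colon (ideal_ring R) Mid).
have [EA|/existsNP[e /not_implyP[Ee nAe]]] := pselect (colon M M `<=` A).
  have EE : colon M M = A by apply/seteqP; split=> //; exact: ring_set_colon.
  have := stab Mid; rewrite /ideal_star_stable /=; have [_ <-] := Mst.
  by rewrite EE => ->; exact: ring_set1.
(* An element [e] of [(M : M)] outside [R] forces [M = (R : (1, e))]. *)
have [F [Ffg F1 Fe Fmin]] := fg_pair e (oner_neq0 {fraction R}).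
have [Fid _] := Ffg; have Cid := ideal_colon (ideal_ring R) Fid.
have Cst : star_ideal star (colon A F).
  by apply: star_ideal_colon => //; exact: star_ideal_ring.
have MF m f : M m -> F f -> A (m * f).
  move=> Mm; suff : F `<=` [set f | A (m * f)] by apply.
  apply: Fmin => /=; first split => /=.
  - by rewrite mulr0; exact: ring_set0.
  - by move=> x y /= Ax Ay; rewrite mulrDr; exact: ring_setD.
  - by move=> r x /= Ax; rewrite mulrCA; apply: ring_setM => //; exact: ring_setP.
  - by rewrite mulr1; exact: MA.
  - by rewrite mulrC; apply: MA; have /colonP := Ee; exact.
have CM : colon A F = M.
  have [_ Mmax] := MM; apply: Mmax.
    apply: proper_star_idealP => //.
      by move=> c /colonP cF; rewrite -[c]mulr1; exact: cF.
    by move=> /colonP /(_ _ Fe); rewrite mul1r.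
  by move=> m Mm; apply/colonP => f; exact: MF.
have MCst := star_ideal_star hstar MCid.
(* F <= (R : M), so F M <= M (R : M); with M = (R : F), the invertibility of [F] passes to [M]. *)
apply: (star_cancel hstar (ideal_prod Fid Cid)) => //.
  exact: fg_integral_inverse.
rewrite CM => c; rewrite mul1r => FMc; apply: star_extensive => //.
move: c FMc; apply: prod_set_sub; first exact: ideal_submodule.
move=> f m Ff Mm; rewrite mulrC; apply: prod_set_mul => //.
by apply/colonP => m' Mm'; rewrite mulrC; exact: MF.
Qed.

Lemma invertible_prod I J : ideal I -> ideal J ->
  invertible I -> invertible J -> invertible (prod_set I J).
Proof.
move=> Iid Jid Iinv Jinv; have Aid := ideal_ring R.
have ICid := ideal_prod Iid (ideal_colon Aid Iid).
have JCid := ideal_prod Jid (ideal_colon Aid Jid).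
have IJid := ideal_prod Iid Jid.
have Pid := ideal_prod IJid (ideal_colon Aid IJid).
rewrite -[1]mulr1; apply: (star_mul2 hstar ICid JCid) => //; first exact: star_ideal_star.
move=> _ _ [n [x [a [xa ->]]]] [m [y [b [yb ->]]]].
have Psub := ideal_submodule (star_ideal_closed hstar Pid).
rewrite mulr_suml; apply: submodule_sum => // i _.
rewrite mulr_sumr; apply: submodule_sum => // j _.
have [Ix /colonP Ca] := xa i; have [Jy /colonP Cb] := yb j.
rewrite mulrACA; apply: star_extensive => //; apply: prod_set_mul.
  exact: prod_set_mul.
apply/colonP => _ [k [x' [y' [xy' ->]]]].
rewrite mulr_sumr; apply: submodule_sum; first exact: ring_set_submodule.
move=> l _; have [Ix' Jy'] := xy' l.
by rewrite mulrACA; apply: ring_setM; [exact: Ca | exact: Cb].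
Qed.

Section Sequence.
Variables (Ms : nat -> set {fraction R}) (a : {fraction R}).
Hypothesis MsM : forall n, star_Max (Ms n).
Hypothesis Ms_inj : injective Ms.
Hypothesis Msa : forall n, Ms n a.
Hypothesis a0 : a != 0.

Fixpoint partial_prod n : set {fraction R} :=
  if n is m.+1 then prod_set (Ms m) (partial_prod m) else A.
Local Notation B := partial_prod.
Local Notation J n := (colon A (B n)).

Lemma ideal_partial_prod n : ideal (B n).
Proof.
elim: n => [|n IHn]; first exact: ideal_ring.
by apply: ideal_prod => //; exact: star_Max_ideal (MsM n).
Qed.

Lemma invertible_partial_prod n : invertible (B n).
Proof.
have AA : ideal (prod_set A (colon A A)).
  by apply: ideal_prod; [| apply: ideal_colon]; exact: ideal_ring.
elim: n => [|n IHn] /=.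
  apply: star_extensive => //; rewrite -[1]mulr1.
  by apply: prod_set_mul; [exact: ring_set1 | exact: colon1].
apply: invertible_prod => //; first exact: star_Max_ideal (MsM n).
  exact: ideal_partial_prod.
exact: star_Max_invertible.
Qed.

Lemma star_ideal_dual n : star_ideal star (J n).
Proof.
by apply: star_ideal_colon; [| exact: ideal_partial_prod | exact: star_ideal_ring].
Qed.

Lemma partial_prod_decr n : B n.+1 `<=` B n.
Proof.
apply: prod_set_sub; first exact/ideal_submodule/ideal_partial_prod.
move=> x y Mx By; apply: submoduleM => //.
  exact/ideal_submodule/ideal_partial_prod.
exact: (star_Max_ring (MsM n)).
Qed.

Lemma dual_incr m n : (m <= n)%N -> J m `<=` J n.
Proof.
move=> /subnKC <-; elim: (n - m)%N => [|k IHk]; first by rewrite addn0.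
rewrite addnS => x /IHk /colonP xB; apply/colonP => y /partial_prod_decr.
exact: xB.
Qed.

Lemma star_Max_neq M N : star_Max M -> star_Max N -> M <> N ->
  exists2 s, M s & outside N s.
Proof.
move=> [MP Mmax] [NP _] MN; apply: contrapT => nMN; apply: MN; apply/esym.
apply: Mmax => // x Mx; apply: contrapT => Nx; apply: nMN; exists x => //.
by split=> //; have [[_ MA] _ _] := MP; exact: MA.
Qed.

(** By maximality each factor different from M has an element outside M; the product of these
    elements carries [B k] into [B m], so both have the same localization at M. *)
Lemma outside_partial_prod M k m : star_Max M ->
  (forall n, (k <= n < m)%N -> Ms n <> M) -> (k <= m)%N ->
  exists2 s, outside M s & forall b, B k b -> B m (s * b).
Proof.
move=> MM kM /subnKC km; move: km kM => <-; elim: (m - k)%N => [|n IHn] kM.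
  by exists 1; [exact: (outside1 MM) | move=> b; rewrite addn0 mul1r].
have [|s Os sB] := IHn.
  by move=> i /andP[ki ikn]; apply: kM; rewrite ki addnS ltnS ltnW.
have [|t Mt Ot] := star_Max_neq (MsM (k + n)) MM.
  by apply: kM; rewrite leq_addr addnS ltnS leqnn.
exists (t * s); first exact: (outsideM hstar).
by move=> b /sB Bsb; rewrite addnS /= -mulrA; exact: prod_set_mul.
Qed.

(** The inductive step tests a z on M_n, where the previous dual applies, and on an element s of B_n
    outside M_n, where [a] is used as an element of M_n. *)
Lemma dual_bounded n z : J n z -> A (a * z).
Proof.
elim: n z => [|n IHn] z /colonP zB.
  have Az : A z by rewrite -[z]mulr1; apply: zB; exact: ring_set1.
  by apply: ring_setM => //; exact: star_Max_ring (MsM 0) _ (Msa 0).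
have [|//|s Os sB] := @outside_partial_prod (Ms n) 0 n (MsM n).
  by move=> m /= mn /Ms_inj; move: mn => /[swap] ->; rewrite ltnn.
apply: (star_Max_conductor hstar (MsM n) (star_ideal_ring hstar) _ Os).
  move=> c Mc; rewrite mulrCA; apply: IHn; apply/colonP => b Bb.
  by rewrite [c * z]mulrC -mulrA; apply: zB; exact: prod_set_mul.
have -> : s * (a * z) = z * (a * (s * 1)).
  by rewrite mulr1 mulrCA [RHS]mulrCA [z * s]mulrC.
by apply: zB; apply: prod_set_mul => //; apply: sB; exact: ring_set1.
Qed.

Lemma star_Max_sequence_absurd : False.
Proof.
pose F := [set X | exists n, X = J n]; pose U := \bigcup_(X in F) X.
have aAid : ideal (scale_set a^-1 A).
  by apply: ideal_scale; [rewrite invr_eq0 | exact: ideal_ring].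
have FU X : F X -> submodule X.
  by move=> [n ->]; have [/ideal_submodule] := star_ideal_dual n.
have Fnz : exists X, F X by exists (J 0), 0%N.
have Ust : star_ideal star U.
  apply: (star_ideal_directed hstar hft) aAid _ => //.
  - by move=> _ [n ->]; exact: star_ideal_dual.
  - move=> _ _ [m ->] [n ->]; exists (J (maxn m n)); split; first by exists (maxn m n).
      by apply: dual_incr; rewrite leq_maxl.
    by apply: dual_incr; rewrite leq_maxr.
  - move=> _ [n ->] x /dual_bounded Aax; exists (a * x) => //.
    by rewrite mulKf.
have [Uid UE] := Ust; have Usub := ideal_submodule Uid.
have BJid n : ideal (prod_set (B n) (J n)).
  by apply: ideal_prod; [exact: ideal_partial_prod | case: (star_ideal_dual n)].
have JU n : J n `<=` U by move=> x Jx; exists (J n) => //; exists n.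
(* A star-maximal ideal is equal to at most one of the [Ms n], so [U R_M] is the
   localization of some invertible [J k]. *)
have EA : colon U U `<=` A.
  move=> x /colonP xU; apply: (star_local_global hstar hft) => [|M MM].
    exact: star_ideal_ring.
  have [k kM] : exists k, forall n, (k <= n)%N -> Ms n <> M.
    have [[k kM]|nM] := pselect (exists k, Ms k = M); last first.
      by exists 0%N => n _ nE; apply: nM; exists n.
    by exists k.+1 => n kn nE; move: kn; rewrite (Ms_inj (etrans nE (esym kM))) ltnn.
  (* [1] is in the closure of a finitely generated G inside B_k J_k, so that one denominator serves
     for all of x G. *)
  have [G [Gfg GB G1]] := star_fg hft (BJid k) (invertible_partial_prod k).
  have [Gid _] := Gfg.
  have [|s Os sG] := @local_fg _ _ hstar M A G x MM (ring_set_submodule R) Gfg.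
    move=> c /GB; move: c.
    have [K0 KD KM] := local_submodule hstar MM (ring_set_submodule R).
    suff : prod_set (B k) (J k) `<=` [set c | local M A (x * c)] by [].
    apply: prod_set_sub; first split => /=.
    - by rewrite mulr0.
    - by move=> u v /= Ku Kv; rewrite mulrDr; exact: KD.
    - by move=> r u /= Ku; rewrite mulrCA; exact: KM.
    (* x j is in some dual J_m; from k on no factor equals [M], so some s outside [M] carries b into
       B_(max k m), which x j maps into [R]. *)
    move=> b j Bb Jj /=; have [_ [m ->] Jm] := xU _ (JU k _ Jj).
    have [|s Os sB] := @outside_partial_prod M k (maxn k m) MM _ (leq_maxl _ _).
      by move=> n /andP[kn _]; exact: kM.
    exists s => //; have /colonP := dual_incr (leq_maxr k m) Jm.
    have -> : s * (x * (b * j)) = (x * j) * (s * b) by ring.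
    by apply; exact: sB.
  by exists s => //; apply: (star_cancel hstar Gid G1) => //; exact: star_ideal_ring.
have {}EA : colon U U = A by apply/seteqP; split=> //; exact: ring_set_colon.
have Cid := ideal_colon (ideal_ring R) Uid; set C := colon A U in Cid.
have UC1 : star (prod_set U C) 1.
  by have := stab Uid; rewrite /ideal_star_stable /= -UE EA => ->; exact: ring_set1.
(* As U is invertible, [1] is in the closure of a finitely generated ideal inside U C, hence inside
   a single J_n C. *)
have [G [Gfg GUC G1]] := star_fg hft (ideal_prod Uid Cid) UC1.
have [Gid _] := Gfg.
pose FC := [set X | exists n, X = prod_set (J n) C].
have FCsub X : FC X -> submodule X.
  by move=> [n ->]; apply/prod_set_submodule/FU; exists n.
have JCmono m n : (m <= n)%N -> prod_set (J m) C `<=` prod_set (J n) C.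
  move=> mn; apply: prod_set_sub; first by apply: FCsub; exists n.
  by move=> x y /(dual_incr mn) Jx Cy; exact: prod_set_mul.
have FCdir X Y : FC X -> FC Y -> exists Z, [/\ FC Z, X `<=` Z & Y `<=` Z].
  move=> [m ->] [n ->]; exists (prod_set (J (maxn m n)) C).
  by split; [exists (maxn m n) | apply: JCmono; exact: leq_maxl |
    apply: JCmono; exact: leq_maxr].
have FCnz : exists X, FC X by exists (prod_set (J 0) C), 0%N.
have GFC : G `<=` \bigcup_(X in FC) X.
  apply: (subset_trans GUC); apply: prod_set_sub; first exact: submodule_directed.
  move=> x y [_ [n ->] Jx] Cy; exists (prod_set (J n) C); first by exists n.
  exact: prod_set_mul.
have [_ [n ->] GJ] := fg_sub_directed FCnz FCsub FCdir Gfg GFC.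
(* For z in U, z J_n C <= J_n because z C <= R; cancelling G stops the increasing sequence at n. *)
have JS : J n.+1 `<=` J n.
  move=> z Jz; apply: (star_cancel hstar Gid G1 (star_ideal_dual n)).
  move=> _ /GJ [i [x [y [xy ->]]]]; rewrite mulr_sumr; apply: submodule_sum.
    by apply: FU; exists n.
  move=> l _; have [Jx /colonP Cy] := xy l; rewrite mulrCA mulrC.
  apply: (@submoduleM _ (J n)) => //; first by apply: FU; exists n.
  by rewrite mulrC; apply: Cy; exact: JU Jz.
(* Now B_(n+1) J_(n+1) <= M_n B_n J_n <= M_n, although the closure of the left side contains [1]. *)
apply: (star_Max1 (MsM n)).
have Mst := star_Max_star (MsM n); have [Mid _] := Mst.
apply: (star_sub hstar (BJid n.+1) Mst _ (invertible_partial_prod n.+1)).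
apply: prod_set_sub; first exact: ideal_submodule.
move=> _ z [i [x [y [xy ->]]]] /JS /colonP zB; rewrite mulr_suml.
apply: submodule_sum; first exact: ideal_submodule.
move=> l _; have [Mx By] := xy l; rewrite -mulrA mulrC.
by apply: submoduleM => //; [exact: ideal_submodule | rewrite mulrC; exact: zB].
Qed.
End Sequence.

Lemma finite_character_of_stable : star_finite_character star.
Proof.
(* An infinite set receives an injection from the natural numbers, here a sequence of distinct
   star-maximal ideals containing a. *)
move=> a a0; apply: contrapT => /infiniteP /pcard_leP /unsquash f.
have fP n : [set M | star_Max M /\ M (tofrac a)] (f n) by exact: funS.
apply: (@star_Max_sequence_absurd f (tofrac a)).
- by move=> n; have [] := fP n.
- by move=> m n fmn; apply: (@inj _ _ _ f); rewrite ?inE.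
- by move=> n; have [] := fP n.
- by rewrite tofrac_eq0.
Qed.
End FiniteCharacter.

(** * Equivalence of the six conditions, with (iv) as the hub, and the equality with [w_op] *)

Theorem theorem4p6 (R : idomainType)
    (star : set {fraction R} -> set {fraction R})
    (hstar : star_operation star) (hft : finite_type star) :
  let c1 := star_integrally_closed star /\ star_stable star in
  let c2 := star_integrally_closed (star_tilde star) /\
            star_stable (star_tilde star) in
  let c3 := integrally_closed R /\ star_stable (star_tilde star) in
  let c4 := star_stable star /\ PstarMD star in
  let c5 := [/\ strongly_star_discrete star, PstarMD star &
                star_finite_character star] in
  let c6 := [/\ integrally_closed R, strongly_star_discrete star &
                clifford_star_regular (star_tilde star)] in
  [<-> c1; c2; c3; c4; c5; c6] /\
  (c1 \/ c2 \/ c3 \/ c4 \/ c5 \/ c6 ->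
   forall I : set {fraction R}, ideal I -> star_tilde star I = w_op I).
Proof.
move=> c1 c2 c3 c4 c5 c6.
have ht := star_tilde_operation hstar hft.
have c14 : c1 -> c4 by move=> [icl st]; split=> //; exact: PstarMD_of_stable.
have c42 : c4 -> c2.
  move=> [st pmd]; split.
    exact/(star_integrally_closed_of_PstarMD ht)/PstarMD_tilde.
  by apply: (star_stable_ext hstar) st => I Iid; rewrite star_tildeE.
have c23 : c2 -> c3 by move=> [icl st]; split=> //; exact: integrally_closed_of_star icl.
have c34 : c3 -> c4.
  move=> [icl st]; have pmd : PstarMD star.
    apply: PstarMD_of_tilde => //; apply: PstarMD_of_stable => //.
    exact: tilde_integrally_closed.
  by split=> //; apply: (star_stable_ext ht) st => I Iid; rewrite star_tildeE.
have c45 : c4 -> c5.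
  move=> [st pmd]; split=> //; first exact: strongly_star_discrete_of_stable.
  exact: finite_character_of_stable.
have c54 : c5 -> c4 by move=> [disc pmd fc]; split=> //; exact: stable_of_discrete.
have tildeE I J : PstarMD star -> ideal I -> ideal J ->
    star_tilde star (prod_set (prod_set I I) J) = star (prod_set (prod_set I I) J).
  by move=> pmd Iid Jid; rewrite star_tildeE //; do 2 apply: ideal_prod => //.
have c46 : c4 -> c6.
  move=> c; have [icl _] := c23 (c42 c); have [disc pmd _] := c45 c; split=> //.
  have [st _] := c; move=> I Iid.
  have [J Jid IJ] := clifford_of_stable hstar st Iid.
  by exists J => //; rewrite tildeE // star_tildeE.
have c61 : c6 -> c1.
  move=> [icl disc reg]; have pmd := PstarMD_of_clifford hstar hft icl reg.
  split; first exact: star_integrally_closed_of_PstarMD.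
  apply: stable_of_clifford => // I Iid; have [J Jid] := reg I Iid.
  by rewrite tildeE // star_tildeE //; exists J.
(* Two links of the cycle, from (i) to (ii) and from (v) to (vi), pass through (iv). *)
split; first by tfae=> //; [move=> /c14 | move=> /c54].
move=> c I Iid; apply: star_tilde_w => //.
suff [] : c4 by [].
by case: c => [/c14|[/c23 /c34|[/c34|[|[/c54|/c61 /c14]]]]].
Qed.
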